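(* Let $X=(X_1,\dots,X_n)$ be a vector of independent random variables taking values in a measurable space $\mathcal{X}$. Fix $\delta\in(0,1]$ and let $F=F(X)\in L^{2+\delta}(P)$ be a real-valued measurable function of $X$ that is centered ($E[F]=0$) with $\sigma^2:=\mathrm{Var}(F)\in(0,\infty)$. For any $\alpha,\beta\in[0,1]$, put $Z^{(\alpha)}:=\sum_{k=1}^n\mathfrak{D}_kF\,\mathfrak{D}_k^{(\alpha)}F$. Then $$d_1(F/\sigma,N)\leq \frac{2}{\sigma^{2+\delta}}\sum_{k=1}^nE\left[(|\mathfrak{D}_kF|^{\delta}+E_k|\mathfrak{D}_kF|^{\delta})\,|\mathfrak{D}^{(\beta)}_kZ^{(\alpha)}|\right]+\frac{2^{1+\delta}}{\sigma^{2+\delta}}\sum_{k=1}^nE\left[(|\mathfrak{D}_kF|^{1+\delta}+E_k|\mathfrak{D}_kF|^{1+\delta})\,|\mathfrak{D}_k^{(\alpha)}F|\right],$$ and the right-hand side above is in turn bounded by $$\frac{4}{\sigma^{2+\delta}}\Big(\sum_{k=1}^nE|\mathfrak{D}_kF|^{2+\delta}\Big)^{\frac{\delta}{2+\delta}}\Big(\sum_{k=1}^nE|\mathfrak{D}_kZ^{(\alpha)}|^{\frac{2+\delta}{2}}\Big)^{\frac{2}{2+\delta}}+\frac{2^{2+\delta}}{\sigma^{2+\delta}}\sum_{k=1}^nE|\mathfrak{D}_kF|^{2+\delta}.$$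
   Context: All random variables live on a probability space $(\Omega,\mathfrak{F},P)$; $E|Y|^p$ means $E[|Y|^p]$. $N$ is a standard normal random variable. The Wasserstein distance is $d_1(G,N):=\sup\{|E[h(G)]-E[h(N)]| : h\in\mathcal{C}^1,\ \|h'\|_\infty\le 1\}$, where $\mathcal{C}^1$ is the space of continuously differentiable $h:\mathbb{R}\to\mathbb{R}$ and $\|\cdot\|_\infty$ is the supremum norm. Let $\mathcal{F}_i:=\sigma(X_k,k\le i)$ and $\mathcal{G}_i:=\sigma(X_k,k\ge i)$ for $1\le i\le n$. For a random variable $U=U(X)\in L^1(P)$ and $1\le i\le n$, $E_i[U]$ denotes the expectation with respect to $X_i$ only (i.e. $X_i$ is integrated out and the other coordinates are kept; equivalently $E_i[U]=E[U\mid X_j,j\ne i]$). The difference operators are $\mathfrak{D}_iU:=U-E_i[U]$ and, for $\alpha\in[0,1]$, $\mathfrak{D}^{(\alpha)}_iU:=\alpha E[\mathfrak{D}_iU\mid\mathcal{F}_i]+(1-\alpha)E[\mathfrak{D}_iU\mid\mathcal{G}_i]$. $E_k|\mathfrak{D}_kF|^{p}$ means $E_k[|\mathfrak{D}_kF|^p]$. *)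

(* Defs.v *)
From HB Require Import structures.
From mathcomp Require Import all_boot all_order all_algebra.
From mathcomp Require Import all_classical all_reals all_analysis.

Set Implicit Arguments.
Unset Strict Implicit.
Unset Printing Implicit Defensive.

Import Order.TTheory GRing.Theory Num.Theory.
Import numFieldNormedType.Exports.

Local Open Scope classical_set_scope.
Local Open Scope ring_scope.

Section conditional_expectation.
Context d (T : measurableType d) (R : realType) (P : probability T R).

(* [V] is a version of E[U | G], for [U] integrable and [G] a sub-sigma-algebra. *)
Definition is_condexp (G : set (set T)) (U V : T -> R) : Prop :=
  [/\ preimage_set_system setT V measurable `<=` G,
      P.-integrable setT (EFin \o V) &
      forall A, G A ->
        (\int[P]_(w in A) (V w)%:E = \int[P]_(w in A) (U w)%:E)%E].

(* An arbitrary version of E[U | G]; the value [cst 0] is only taken when no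
   version exists, which does not happen for [U] integrable. *)
Definition condexp (G : set (set T)) (U : T -> R) : T -> R :=
  xget (cst 0) [set V | is_condexp G U V].

End conditional_expectation.

Section difference_operators.
Context d d' (T : measurableType d) (E : measurableType d') (R : realType).
Variables (P : probability T R) (n : nat) (X : 'I_n -> {RV P >-> E}).

Definition mutually_independent : Prop :=
  forall (J : {set 'I_n}) (B : 'I_n -> set E),
    (forall i, measurable (B i)) ->
    (P (\bigcap_(i in [set` J]) (X i @^-1` B i)) =
     \prod_(i in J) P (X i @^-1` B i))%E.

(* sigma(X_i, i \in S) *)
Definition sigma_coords (S : set 'I_n) : set (set T) :=
  <<s \bigcup_(i in S) preimage_set_system setT (X i) measurable >>.

Definition past (i : 'I_n) := sigma_coords [set k | (k <= i)%N].

Definition future (i : 'I_n) := sigma_coords [set k | (i <= k)%N].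

(* Integrating out the coordinate [X i] alone, that is, conditioning on all the
   other coordinates. *)
Definition Ecoord (i : 'I_n) (U : T -> R) : T -> R :=
  condexp P (sigma_coords [set j | j != i]) U.

Definition Dcoord (i : 'I_n) (U : T -> R) : T -> R :=
  fun w => U w - Ecoord i U w.

Definition Dcoord_mix (alpha : R) (i : 'I_n) (U : T -> R) : T -> R :=
  fun w => alpha * condexp P (past i) (Dcoord i U) w
         + (1 - alpha) * condexp P (future i) (Dcoord i U) w.

Definition Zmix (alpha : R) (U : T -> R) : T -> R :=
  fun w => \sum_(k < n) Dcoord k U w * Dcoord_mix alpha k U w.

End difference_operators.

Section wasserstein.
Context d1 d2 (T1 : measurableType d1) (T2 : measurableType d2) (R : realType).

Definition C1 (h : R -> R) : Prop :=
  (forall x, derivable h x 1) /\ continuous (derive1 h).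

(* The two variables may live on different probability spaces. *)
Definition wasserstein (P1 : probability T1 R) (P2 : probability T2 R)
    (G1 : T1 -> R) (G2 : T2 -> R) : \bar R :=
  ereal_sup [set `| 'E_P1[h \o G1] - 'E_P2[h \o G2] |%E
            | h in [set h : R -> R | C1 h /\ forall x, `|derive1 h x| <= 1]].

End wasserstein.

(* Main.v *)
Require Import Defs.
From HB Require Import structures.
From mathcomp Require Import all_boot all_order all_algebra.
From mathcomp Require Import all_classical all_reals all_analysis.
From mathcomp Require Import measurable_realfun finmap.
From mathcomp Require Import ring lra.

Set Implicit Arguments.
Unset Strict Implicit.
Unset Printing Implicit Defensive.

Import Order.TTheory GRing.Theory Num.Theory.
Import numFieldNormedType.Exports.

Local Open Scope classical_set_scope.
Local Open Scope ring_scope.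

(** Stein's method, driven by a martingale covariance identity.

    Let [h] have derivative bounded by 1. The solution [f] of Stein's equation
    [f' x - x f x = h x - E h(N)] satisfies [|f'| <= 1] and [|f''| <= 2], so that
    [f'] is Hölder continuous of every order [delta] in ]0, 1] with constant 2
    ([stein_smooth]). At [x = F / sigma] and with [g x = f (x / sigma)], the
    quantity [E h(F / sigma) - E h(N)] becomes
    [sigma^-1 (sigma^2 E g'(F) - E (F g(F)))] ([wasserstein_stein_le]).

    The covariance identity ([covariance_Dcoord]) states that
    [Cov(U, V)] is the sum over [k] of [E (D_k U D_k^(a) V)] when [V] is a
    function of [X]. By independence, successive conditionings on two blocks of
    coordinates amount to conditioning on their intersection
    ([is_condexp_setI]); hence [E (D_k V | F_k) = E (V | F_k) - E (V | F_{k-1})],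
    and [E (D_k U E (D_k V | F_k))] equals
    [E (U E (V | F_k)) - E (U E (V | F_{k-1}))]. These terms telescope; the
    future sigma-algebras are treated in the same way from the other end.

    Applied to [(F, F)], the identity gives [E Z = sigma^2]; applied to
    [(g(F), F)] and to [(g'(F), Z)], it turns [E (F g(F)) - sigma^2 E g'(F)] into
    the sum over [k] of
    [E (D_k g'(F) D_k^(b) Z) + E ((D_k g(F) - g'(F) D_k F) D_k^(a) F)].
    Taylor expansions of [g'] and [g] around [E_k F] bound [D_k g'(F)] by the
    powers of order [delta], and [D_k g(F) - g'(F) D_k F] by the powers of order
    [1 + delta], of [|D_k F|] and by their [k]-th conditional expectations, with
    the Hölder constant [2 / sigma^(1 + delta)] of [g'] as a factor
    ([stein_covariance_bound]). This is the first bound, with 2 in place of the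
    second constant [2^(1 + delta)].

    The second bound is Hölder's inequality for the sum over [k] and the
    expectation together ([Dsum_holder]), because conditional expectation does
    not increase moments ([is_condexp_powR_le], [Dcoord_mix_moment_le]).

    Conditional expectations are only defined up to null sets, and most of the
    proof is about the relation [is_condexp], of which [condexp] is an instance
    as soon as the function is integrable ([condexp_exists]). *)

(** * Existence of conditional expectations *)

Definition measurable_wrt T (R : realType) (G : set (set T)) (V : T -> R) :=
  preimage_set_system setT V measurable `<=` G.

Section measurable_wrt_theory.
Context d (T : measurableType d) (R : realType).
Implicit Types (G : set (set T)) (U V : T -> R).

Lemma measurable_wrtP G V : sigma_algebra setT G ->
  measurable_wrt G V <-> measurable_fun setT (V : g_sigma_algebraType G -> R).
Proof.
move=> sG; split => [GV _ B mB|mV _ [B mB <-]].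
  by apply: sub_sigma_algebra; apply: GV; exists B.
by have := mV measurableT B mB; rewrite measurable_g_measurableTypeE.
Qed.

Lemma measurable_wrtW G V : G `<=` measurable -> measurable_wrt G V ->
  measurable_fun setT V.
Proof. by move=> mG GV _ B mB; apply: mG; apply: GV; exists B. Qed.

Lemma measurable_wrtS G G' V : G `<=` G' -> measurable_wrt G V ->
  measurable_wrt G' V.
Proof. by move=> GG' + A VA; move=> /(_ A VA)/GG'. Qed.

Lemma measurable_idfun_sub G : sigma_algebra setT G -> G `<=` measurable ->
  measurable_fun setT (idfun : T -> g_sigma_algebraType G).
Proof.
move=> sG mG _ B; rewrite measurable_g_measurableTypeE// => GB.
by rewrite setTI; exact: mG.
Qed.

End measurable_wrt_theory.

Lemma Radon_Nikodym_real d (T : measurableType d) (R : realType)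
    (nu : {charge set T -> \bar R}) (mu : {sigma_finite_measure set T -> \bar R}) :
  nu `<< mu -> exists V : T -> R, mu.-integrable setT (EFin \o V) /\
    forall A, measurable A -> nu A = (\int[mu]_(w in A) (V w)%:E)%E.
Proof.
move=> numu; have VE : EFin \o (fine \o Radon_Nikodym nu mu) = Radon_Nikodym nu mu.
  by apply/funext => w /=; rewrite fineK// Radon_Nikodym_fin_num.
exists (fine \o Radon_Nikodym nu mu); rewrite VE; split.
  exact: Radon_Nikodym_integrable.
move=> A mA; rewrite (Radon_Nikodym_integral numu mA).
by apply: eq_integral => w _; rewrite /= fineK// Radon_Nikodym_fin_num.
Qed.

(** The Radon-Nikodym theorem is used on the space that carries [G] as its full
    sigma-algebra, where the density is automatically [G]-measurable; the
    identity map into that space transports the measure and the integrals. *)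
Section condexp_existence.
Context d (T : measurableType d) (R : realType) (P : probability T R).
Variable G : set (set T).
Hypotheses (sG : sigma_algebra setT G) (mG : G `<=` measurable).
Let idG : T -> g_sigma_algebraType G := idfun.
Let midG : measurable_fun setT idG. Proof. exact: measurable_idfun_sub. Qed.
HB.instance Definition _ := isMeasurableFun.Build _ _ _ _ idG midG.
Let PG := distribution P idG.

Lemma condexp_exists U : P.-integrable setT (EFin \o U) ->
  exists V, is_condexp P G U V.
Proof.
move=> iU.
pose nu0 : {charge set (g_sigma_algebraType G) -> \bar R} :=
  pushforward (induced_charge iU) idG.
pose nu := nu0 midG.
have nuE A : nu A = (\int[P]_(w in A) (U w)%:E)%E by [].
have nuP : nu `<< PG.
  apply/null_content_dominatesP => A mA PA0; rewrite nuE.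
  have mA' : d.-measurable (A : set T).
    by move: mA; rewrite measurable_g_measurableTypeE// => /mG.
  have mU := measurable_funS measurableT (@subsetT _ (A : set T))
    (measurable_int _ iU).
  exact: (null_set_integral mA' mU PA0).
have [V [iV VE]] := Radon_Nikodym_real nuP.
have mV : measurable_fun setT V by apply/measurable_EFinP; exact: measurable_int iV.
have mVT : measurable_fun (setT : set T) V := measurableT_comp mV midG.
have iVP : P.-integrable setT (EFin \o V).
  apply/integrableP; split; first exact/measurable_EFinP.
  move/integrableP : iV => [_]; apply: le_lt_trans.
  rewrite ge0_integral_pushforward//.
  exact/measurable_EFinP/measurableT_comp.
exists V; split => //.
- by apply/measurable_wrtP.
- move=> A GA; have mA := mG GA.
  have mA' : @measurable _ (g_sigma_algebraType G) A.
    by rewrite measurable_g_measurableTypeE.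
  rewrite -[RHS](nuE A) (VE A)// integral_pushforward//.
  + exact/measurable_EFinP.
  + exact: integrableS iVP.
Qed.

End condexp_existence.

(** * Integration of real-valued functions *)

Lemma measurable_sgr (R : realType) : measurable_fun setT (@Num.sg R).
Proof.
apply: nondecreasing_measurable => // x y xy.
have [x0|x0|x0] := ltgtP x 0.
- by rewrite (ltr0_sg x0); have [y0|y0|->] := ltgtP y 0;
    rewrite ?(ltr0_sg y0) ?(gtr0_sg y0) ?sgr0//; lra.
- by rewrite !gtr0_sg// (lt_le_trans x0).
- by rewrite x0 sgr0 sgr_ge0 -x0.
Qed.

Lemma normr_sg_le1 (R : realType) (x : R) : `|Num.sg x| <= 1.
Proof. by rewrite normr_sg; case: (x != 0). Qed.

Section real_integrals.
Context d (T : measurableType d) (R : realType) (mu : {measure set T -> \bar R}).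
Implicit Types (f g H U V : T -> R).

Definition integ U := mu.-integrable setT (EFin \o U).

Lemma integ_measurable U : integ U -> measurable_fun setT U.
Proof. by move=> iU; apply/measurable_EFinP; exact: measurable_int iU. Qed.

Lemma integ_le U V : measurable_fun setT U -> integ V ->
  (forall w, `|U w| <= V w) -> integ U.
Proof.
move=> mU iV UV; apply: le_integrable iV => //; first exact/measurable_EFinP.
by move=> w _; rewrite /= lee_fin (le_trans (UV w))// ler_norm.
Qed.

Lemma integ_ae_le U V : measurable_fun setT U -> integ V ->
  {ae mu, forall w, `|U w| <= V w} -> integ U.
Proof.
move=> mU /integrableP[mV Voo] UV; apply/integrableP.
split; first exact/measurable_EFinP.
apply: le_lt_trans Voo; apply: ae_ge0_le_integral => //.
- by apply: measurableT_comp => //; exact/measurable_EFinP.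
- exact: measurableT_comp.
- by apply: filterS UV => w UVw _; rewrite /= lee_fin (le_trans UVw)// ler_norm.
Qed.

Lemma integD U V : integ U -> integ V -> integ (fun w => U w + V w).
Proof. by move=> iU iV; exact: (integrableD measurableT iU iV). Qed.

Lemma integB U V : integ U -> integ V -> integ (fun w => U w - V w).
Proof. by move=> iU iV; exact: (integrableB measurableT iU iV). Qed.

Lemma integZ c U : integ U -> integ (fun w => c * U w).
Proof. by move=> iU; exact: (integrableZl measurableT c iU). Qed.

Lemma integ_norm U : integ U -> integ (fun w => `|U w|).
Proof. exact: integrable_norm. Qed.

Lemma integM_bounded H U M : measurable_fun setT H -> (forall w, `|H w| <= M) ->
  integ U -> integ (fun w => H w * U w).
Proof.
move=> mH HM iU.
apply: (integ_le _ (integZ M (integ_norm iU))).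
  by apply: measurable_funM => //; exact: integ_measurable.
by move=> w; rewrite normrM ler_wpM2r.
Qed.

Lemma integM_ae_bounded H U M : measurable_fun setT H ->
  {ae mu, forall w, `|H w| <= M} -> integ U -> integ (fun w => H w * U w).
Proof.
move=> mH HM iU.
apply: (integ_ae_le _ (integZ M (integ_norm iU))).
  by apply: measurable_funM => //; exact: integ_measurable.
by apply: filterS HM => w HMw; rewrite normrM ler_wpM2r.
Qed.

Lemma integ_indic A U : measurable A -> integ U -> integ (fun w => \1_A w * U w).
Proof.
move=> mA; apply: (@integM_bounded _ _ 1); first exact: measurable_indic.
by move=> w; rewrite indicE; case: (w \in A); rewrite ?normr1 ?normr0.
Qed.

Lemma integral_indic_EFin A U :
  (\int[mu]_w (\1_A w * U w)%:E = \int[mu]_(w in A) (U w)%:E)%E.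
Proof.
rewrite [RHS]integral_mkcond; apply: eq_integral => w _.
by rewrite patchE indicE; case: ifPn; rewrite ?mul1r ?mul0r.
Qed.

Lemma Rintegral_indic A U :
  \int[mu]_w (\1_A w * U w) = \int[mu]_(w in A) U w.
Proof. by congr fine; exact: integral_indic_EFin. Qed.

Lemma integ_sum (I : Type) (s : seq I) (F : I -> T -> R) :
  (forall i, integ (F i)) -> integ (fun w => \sum_(i <- s) F i w).
Proof.
move=> iF; elim: s => [|i s ih].
  by under eq_fun do rewrite big_nil; exact: integrable0.
by under eq_fun do rewrite big_cons; exact: integD.
Qed.

Lemma Rintegral_sum (I : Type) (s : seq I) (F : I -> T -> R) :
  (forall i, integ (F i)) ->
  \int[mu]_w (\sum_(i <- s) F i w) = \sum_(i <- s) \int[mu]_w F i w.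
Proof.
move=> iF; elim: s => [|i s ih].
  under eq_Rintegral do rewrite big_nil.
  by rewrite big_nil /Rintegral integral0.
under eq_Rintegral do rewrite big_cons.
by rewrite RintegralD ?ih ?big_cons//; [exact: iF|exact: (integ_sum s iF)].
Qed.

Lemma EFin_Rintegral U : integ U ->
  ((\int[mu]_w U w)%:E = \int[mu]_w (U w)%:E)%E.
Proof. by move=> iU; rewrite fineK//; exact: integrable_fin_num. Qed.

Lemma ae_eq_Rintegral U V : measurable_fun setT U -> measurable_fun setT V ->
  {ae mu, forall w, U w = V w} -> \int[mu]_w U w = \int[mu]_w V w.
Proof.
move=> mU mV UV; congr fine; apply: ae_eq_integral => //.
- exact/measurable_EFinP.
- exact/measurable_EFinP.
- by apply: filterS UV => w /= ->.
Qed.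

Lemma ae_le_Rintegral U V : integ U -> integ V ->
  {ae mu, forall w, U w <= V w} -> \int[mu]_w U w <= \int[mu]_w V w.
Proof.
move=> iU iV UV; rewrite -subr_ge0 -RintegralB//.
rewrite (@ae_eq_Rintegral _ (fun w => `|V w - U w|)).
- exact: Rintegral_ge0.
- by apply: measurable_funB; exact: integ_measurable.
- by apply: measurableT_comp => //; apply: measurable_funB; exact: integ_measurable.
- by apply: filterS UV => w UVw; rewrite ger0_norm// subr_ge0.
Qed.

Lemma Rintegral_ae_eq0 U : integ U -> (forall w, 0 <= U w) ->
  \int[mu]_w U w = 0 -> {ae mu, forall w, U w = 0}.
Proof.
move=> iU U0 IU0.
have [H _] := @ae_eq_integral_abs _ _ _ mu setT measurableT (EFin \o U)
  (measurable_int _ iU).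
have [|N [mN N0 sN]] := H.
  under eq_integral do rewrite /= ger0_norm//.
  by rewrite -EFin_Rintegral// IU0.
exists N; split => // w /= nU; apply: sN => /=.
by apply: contra_not nU => /(_ I) /= [].
Qed.

Lemma dominated_Rintegral_cvg (f_ : nat -> T -> R) f g :
  (forall n, measurable_fun setT (f_ n)) -> measurable_fun setT f ->
  (forall x, f_ ^~ x @ \oo --> f x) -> integ g ->
  (forall n x, `|f_ n x| <= g x) ->
  (fun n => \int[mu]_x f_ n x) @ \oo --> \int[mu]_x f x.
Proof.
move=> mf_ mf f_f ig f_g.
have [||||iF _ +] := @dominated_convergence _ _ _ mu setT measurableT
  (fun n => EFin \o f_ n) (EFin \o f) (EFin \o g) _ _ _ ig.
- by move=> n; exact/measurable_EFinP.
- exact/measurable_EFinP.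
- by apply: aeW => x _; apply: cvg_EFin (f_f x); exact: nearW.
- by apply: aeW => x n _; rewrite /= lee_fin.
- by rewrite -EFin_Rintegral// => /fine_cvg.
Qed.

Lemma fatou_norm (f_ : nat -> T -> R) f (C : \bar R) :
  (forall n, measurable_fun setT (f_ n)) ->
  (forall x, f_ ^~ x @ \oo --> f x) ->
  (forall n, \int[mu]_x `|f_ n x|%:E <= C)%E ->
  (\int[mu]_x `|f x|%:E <= C)%E.
Proof.
move=> mf f_f fC.
have mfE n : measurable_fun setT (fun x => `|f_ n x|%:E).
  by apply/measurable_EFinP; exact: measurableT_comp.
have := fatou mu measurableT mfE (fun n x _ => normr_ge0 (f_ n x)).
under eq_integral => x _.
  have /cvg_limn_einf_sup[-> _] : (fun n => `|f_ n x|%:E) @ \oo --> `|f x|%:E.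
    by apply: cvg_EFin (cvg_norm (f_f x)); exact: nearW.
  over.
move=> /le_trans; apply; rewrite limn_einf_lim; apply: lime_le.
  exact: is_cvg_einfs.
apply: nearW => n; apply: le_trans (fC n); apply: ereal_inf_lbound.
by exists n => /=.
Qed.

End real_integrals.

(** * Factoring out of a conditional expectation *)

Section condexp_pull_out.
Import HBNNSimple.
Context d (T : measurableType d) (R : realType) (P : probability T R).
Variable G : set (set T).
Hypotheses (sG : sigma_algebra setT G) (mG : G `<=` measurable).
Implicit Types (H U V W : T -> R).
Local Notation integ := (integ P).

Lemma measurable_wrt_comp2 (g : R -> R -> R) U V :
  (forall f1 f2 : g_sigma_algebraType G -> R, measurable_fun setT f1 ->
    measurable_fun setT f2 -> measurable_fun setT (fun w => g (f1 w) (f2 w))) ->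
  measurable_wrt G U -> measurable_wrt G V ->
  measurable_wrt G (fun w => g (U w) (V w)).
Proof.
move=> mg /(measurable_wrtP _ sG) mU /(measurable_wrtP _ sG) mV.
by apply/(measurable_wrtP _ sG); exact: mg.
Qed.

Lemma measurable_wrt_comp (g : R -> R) U : measurable_fun setT g ->
  measurable_wrt G U -> measurable_wrt G (fun w => g (U w)).
Proof.
move=> mg /(measurable_wrtP _ sG) mU.
by apply/(measurable_wrtP _ sG); exact: measurableT_comp mg mU.
Qed.

Lemma measurable_wrt_cst c : measurable_wrt G (fun _ : T => c : R).
Proof. by apply/(measurable_wrtP _ sG); exact: measurable_cst. Qed.

Lemma measurable_wrtD U V : measurable_wrt G U -> measurable_wrt G V ->
  measurable_wrt G (fun w => U w + V w).
Proof.
by apply: (@measurable_wrt_comp2 (fun x y => x + y)) => *; exact: measurable_funD.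
Qed.

Lemma measurable_wrtB U V : measurable_wrt G U -> measurable_wrt G V ->
  measurable_wrt G (fun w => U w - V w).
Proof.
by apply: (@measurable_wrt_comp2 (fun x y => x - y)) => *; exact: measurable_funB.
Qed.

Lemma measurable_wrtM U V : measurable_wrt G U -> measurable_wrt G V ->
  measurable_wrt G (fun w => U w * V w).
Proof.
by apply: (@measurable_wrt_comp2 (fun x y => x * y)) => *; exact: measurable_funM.
Qed.

Lemma measurable_wrt_sum (I : Type) (s : seq I) (F : I -> T -> R) :
  (forall i, measurable_wrt G (F i)) ->
  measurable_wrt G (fun w => \sum_(i <- s) F i w).
Proof.
move=> mF; elim: s => [|i s ih].
  by under eq_fun do rewrite big_nil; exact: measurable_wrt_cst.
by under eq_fun do rewrite big_cons; exact: measurable_wrtD.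
Qed.

Lemma measurable_wrt_indic A : G A -> measurable_wrt G (\1_A : T -> R).
Proof.
move=> GA; apply/(measurable_wrtP _ sG); apply: measurable_indic.
by rewrite measurable_g_measurableTypeE.
Qed.

Lemma measurable_wrt_preimage U B : measurable_wrt G U -> measurable B ->
  G (U @^-1` B).
Proof. by move=> GU mB; apply: GU; exists B; rewrite ?setTI. Qed.

Lemma is_condexp_indic U V A : is_condexp P G U V -> G A ->
  \int[P]_w (\1_A w * V w) = \int[P]_w (\1_A w * U w).
Proof.
move=> [_ _ VU] GA; rewrite !Rintegral_indic.
by congr fine; exact: VU.
Qed.

Lemma is_condexpP U V : integ U ->
  measurable_wrt G V -> integ V ->
  (forall A, G A -> \int[P]_w (\1_A w * V w) = \int[P]_w (\1_A w * U w)) ->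
  is_condexp P G U V.
Proof.
move=> iU GV iV VU; split => // A GA.
have mA := mG GA.
rewrite -(integral_indic_EFin P A V) -(integral_indic_EFin P A U).
rewrite -(EFin_Rintegral (integ_indic mA iV)) -(EFin_Rintegral (integ_indic mA iU)).
by rewrite VU.
Qed.

Lemma is_condexp_id V : measurable_wrt G V -> integ V -> is_condexp P G V V.
Proof. by move=> GV iV; exact: is_condexpP. Qed.

(** Approximation of the multiplier by simple functions that are measurable for
    the sub-sigma-algebra. *)
Let pull_ge0_bounded U V H M : integ U -> is_condexp P G U V ->
  measurable_wrt G H -> (forall w, 0 <= H w <= M) ->
  \int[P]_w (H w * V w) = \int[P]_w (H w * U w).
Proof.
move=> iU UV GH HM; have [GV iV _] := UV.
have mH := (measurable_wrtP _ sG).1 GH.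
have mHE := (measurable_EFinP setT (H : g_sigma_algebraType G -> R)).2 mH.
pose g := nnsfun_approx measurableT mHE.
have H0 x : (0 <= (H x)%:E)%E by rewrite lee_fin; case/andP: (HM x).
have gH w : (fun n => g n w) @ \oo --> H w.
  have := cvg_nnsfun_approx measurableT mHE (fun x _ => H0 x) (I : setT w).
  exact: fine_cvg.
have gM n w : `|g n w| <= M.
  rewrite ger0_norm//; apply: (@le_trans _ _ (H w)); last by case/andP: (HM w).
  rewrite -(cvg_lim (@Rhausdorff R) (gH w)).
  apply: (@nondecreasing_cvgn_le _ (fun n => g n w)) => //; last exact: cvgP (gH w).
  by move=> m k mk; exact/lefP/nd_nnsfun_approx.
have mg n : measurable_fun (setT : set T) (g n).
  by apply: (measurable_wrtW mG); apply/(measurable_wrtP _ sG).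
have Gg n r : G (g n @^-1` [set r]).
  by apply: measurable_wrt_preimage => //; apply/(measurable_wrtP _ sG).
(* On a simple multiplier, linearity reduces the claim to indicators. *)
have gE n W : integ W -> \int[P]_w (g n w * W w) =
    \sum_(r <- fset_set (range (g n))) r * \int[P]_w (\1_(g n @^-1` [set r]) w * W w).
  move=> iW; have i1 r : integ (fun w => \1_(g n @^-1` [set r]) w * W w).
    by apply: integ_indic => //; exact/mG/Gg.
  under eq_Rintegral => w _.
    rewrite (fimfunE (g n)) fsbig_finite//= mulr_suml.
    under eq_bigr do rewrite -mulrA.
    over.
  rewrite Rintegral_sum; last by move=> r; exact/integZ/i1.
  by apply: eq_bigr => r _; rewrite RintegralZl//; exact: i1.
have cvgW W : integ W ->
  (fun n => \int[P]_w (g n w * W w)) @ \oo --> \int[P]_w (H w * W w).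
  move=> iW; apply: (@dominated_Rintegral_cvg _ _ _ _ _ _ (fun w => M * `|W w|)).
  - by move=> n; apply: measurable_funM => //; exact: integ_measurable iW.
  - apply: measurable_funM; first exact: measurable_wrtW GH.
    exact: integ_measurable iW.
  - by move=> x; apply: cvgM => //; exact: cvg_cst.
  - exact/integZ/integ_norm.
  - by move=> n x; rewrite normrM ler_wpM2r.
have := cvgW _ iV.
have -> : (fun n => \int[P]_w (g n w * V w)) = (fun n => \int[P]_w (g n w * U w)).
  apply/funext => n; rewrite !gE//; apply: eq_bigr => i _; congr (_ * _).
  exact: is_condexp_indic.
by move=> /cvg_unique; apply => //; exact: cvgW.
Qed.

Lemma condexp_pull_bounded U V H M : integ U -> is_condexp P G U V ->
  measurable_wrt G H -> (forall w, `|H w| <= M) ->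
  \int[P]_w (H w * V w) = \int[P]_w (H w * U w).
Proof.
move=> iU UV GH HM; have [GV iV _] := UV.
have mH := measurable_wrtW mG GH.
have E W : integ W ->
  \int[P]_w ((H w + M) * W w) = \int[P]_w (H w * W w) + M * \int[P]_w W w.
  move=> iW; under eq_Rintegral do rewrite mulrDl.
  rewrite RintegralD ?RintegralZl//; first exact: (integM_bounded mH HM iW).
  exact: (integZ M iW).
have EVU : \int[P]_w U w = \int[P]_w V w.
  have ET W : \int[P]_w (\1_setT w * W w) = \int[P]_w W w.
    by apply: eq_Rintegral => w _; rewrite indicT mul1r.
  rewrite -(ET U) -(ET V); apply/esym/(is_condexp_indic UV).
  by case: sG => G0 GC _; rewrite -(setD0 setT); exact: GC.
(* The shift by [M] makes the multiplier nonnegative. *)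
apply: (addIr (M * \int[P]_w U w)); rewrite {1}EVU.
rewrite -!E//; apply: (@pull_ge0_bounded _ _ _ (M + M)) => //.
  by apply: measurable_wrtD => //; exact: measurable_wrt_cst.
move=> w; have := HM w; rewrite ler_norml => /andP[? ?].
by rewrite lerD2r; lra.
Qed.

Let trunc (m : nat) (x : R) := x * \1_`[- m%:R, m%:R] x.

Let measurable_trunc m : measurable_fun setT (trunc m).
Proof. by apply: measurable_funM => //; exact: measurable_indic. Qed.

Let trunc_le m x : `|trunc m x| <= `|x|.
Proof.
by rewrite /trunc indicE; case: (x \in _); rewrite ?mulr1// mulr0 normr0.
Qed.

Let trunc_bounded m x : `|trunc m x| <= m%:R.
Proof.
rewrite /trunc indicE; case: (boolP (x \in _)) => [/set_mem|_]; last by rewrite mulr0 normr0.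
by rewrite /= in_itv/= mulr1 ler_norml.
Qed.

Let cvg_trunc x : trunc ^~ x @ \oo --> x.
Proof.
apply: cvg_near_cst; near=> m; rewrite /trunc indicE mem_set ?mulr1//=.
rewrite in_itv/= -ler_norml; near: m.
exact: nbhs_infty_ger.
Unshelve. all: by end_near. Qed.

(** The multiplier is truncated. That [H * V] is integrable at all comes from
    taking the sign of the truncated product into the multiplier, which bounds
    its absolute moment by that of [H * U]; Fatou's lemma removes the
    truncation. *)
Lemma condexp_pull U V H : integ U -> is_condexp P G U V ->
  measurable_wrt G H -> integ (fun w => H w * U w) ->
  integ (fun w => H w * V w) /\
  \int[P]_w (H w * V w) = \int[P]_w (H w * U w).
Proof.
move=> iU UV GH iHU; have [GV iV _] := UV.
have mH := measurable_wrtW mG GH; have mU := integ_measurable iU.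
have mV := integ_measurable iV.
have GtH m : measurable_wrt G (fun w => trunc m (H w)).
  exact: measurable_wrt_comp (measurable_trunc m) GH.
have mtH m := measurable_wrtW mG (GtH m).
have itHV m : integ (fun w => trunc m (H w) * V w).
  exact: (integM_bounded (mtH m) (fun w => trunc_bounded m (H w))).
have itHU m : integ (fun w => trunc m (H w) * U w).
  exact: (integM_bounded (mtH m) (fun w => trunc_bounded m (H w))).
have iHV : integ (fun w => H w * V w).
  apply/integrableP; split.
    by apply/measurable_EFinP; exact: measurable_funM.
  apply: (@le_lt_trans _ _ (\int[P]_w `|H w * U w|)%:E); last by rewrite ltry.
  apply: (@fatou_norm _ _ _ _ (fun m w => trunc m (H w) * V w)).
  - by move=> m; exact: measurable_funM.
  - by move=> w; apply: cvgM; [exact: cvg_trunc|exact: cvg_cst].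
  - move=> m; rewrite -EFin_Rintegral; last exact: integ_norm.
    rewrite lee_fin.
    pose K w := Num.sg (trunc m (H w) * V w) * trunc m (H w).
    have K1 w : `|K w| <= `|trunc m (H w)|.
      by rewrite normrM ler_piMl// normr_sg_le1.
    have GK : measurable_wrt G K.
      apply: measurable_wrtM; last exact: GtH.
      apply: (measurable_wrt_comp (@measurable_sgr R)).
      exact: measurable_wrtM.
    have -> : \int[P]_w `|trunc m (H w) * V w| = \int[P]_w (K w * U w).
      rewrite -(@condexp_pull_bounded U V K m%:R)//.
        apply: eq_Rintegral => w _; by rewrite /K normrEsg mulrA.
      by move=> w; exact: le_trans (K1 w) (trunc_bounded _ _).
    apply: le_Rintegral => //.
    + apply: (integM_bounded (measurable_wrtW mG GK) _ iU) => w.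
      exact: le_trans (K1 w) (trunc_bounded _ _).
    + exact: (integ_norm iHU).
    + move=> w _; rewrite (le_trans (ler_norm _))// normrM [leRHS]normrM ler_wpM2r//.
      exact: le_trans (K1 w) (trunc_le _ _).
split => //.
have cvgW W : measurable_fun setT W -> integ (fun w => H w * W w) ->
    (fun m => \int[P]_w (trunc m (H w) * W w)) @ \oo --> \int[P]_w (H w * W w).
  move=> mW iHW.
  apply: (@dominated_Rintegral_cvg _ _ _ _ _ _ (fun w => `|H w * W w|)).
  - by move=> m; exact: measurable_funM.
  - exact: measurable_funM.
  - by move=> w; apply: cvgM; [exact: cvg_trunc|exact: cvg_cst].
  - exact: integ_norm.
  - by move=> m w; rewrite normrM [leRHS]normrM ler_wpM2r.
have := cvgW _ mV iHV.
have -> : (fun m => \int[P]_w (trunc m (H w) * V w)) =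
          (fun m => \int[P]_w (trunc m (H w) * U w)).
  apply/funext => m; apply: condexp_pull_bounded => // w; exact: trunc_bounded.
by move=> /cvg_unique; apply => //; exact: cvgW.
Qed.

End condexp_pull_out.

(** * Order, uniqueness and moments of conditional expectations *)

(** Young's inequality in the form of the tangent to [y `^ r] at [x], linear in
    the quantity that will be averaged. *)
Lemma young_tangent (R : realType) (x y r : R) : 1 < r -> 0 <= x -> 0 <= y ->
  x `^ (r - 1) * y <= y `^ r / r + (1 - r^-1) * x `^ r.
Proof.
move=> r1 x0 y0; have r0 : 0 < r by lra.
have rV : r^-1 < 1 by rewrite invf_lt1.
have q0 : 0 < (1 - r^-1)^-1 by rewrite invr_gt0; lra.
have := @conjugate_powR _ y (x `^ (r - 1)) r (1 - r^-1)^-1 y0 (powR_ge0 _ _) r0 q0.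
rewrite invrK -powRrM => /(_ _); rewrite mulrC.
have -> : (r - 1) * (1 - r^-1)^-1 = r by field; lra.
by rewrite (mulrC (_ `^ r) (1 - _)); apply; lra.
Qed.

Section condexp_properties.
Context d (T : measurableType d) (R : realType) (P : probability T R).
Variable G : set (set T).
Hypotheses (sG : sigma_algebra setT G) (mG : G `<=` measurable).
Implicit Types (H U V W : T -> R).
Local Notation integ := (integ P).

Lemma integ_cst c : integ (fun _ => c).
Proof. exact: finite_measure_integrable_cst. Qed.

Lemma is_condexp_condexp U : integ U -> is_condexp P G U (condexp P G U).
Proof.
by move=> iU; have [V UV] := condexp_exists sG mG iU; apply: (@xgetPex _ (cst 0));
  exists V.
Qed.

Lemma is_condexp_mul H U V : integ U -> is_condexp P G U V ->
  measurable_wrt G H -> integ (fun w => H w * U w) ->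
  is_condexp P G (fun w => H w * U w) (fun w => H w * V w).
Proof.
move=> iU UV GH iHU; have [GV iV _] := UV.
have [iHV _] := condexp_pull sG mG iU UV GH iHU.
apply: is_condexpP => //; first exact: measurable_wrtM.
move=> A GA; under eq_Rintegral do rewrite mulrA.
under [RHS]eq_Rintegral do rewrite mulrA.
have GAH : measurable_wrt G (fun w => \1_A w * H w).
  by apply: measurable_wrtM => //; exact: measurable_wrt_indic.
apply: (condexp_pull sG mG iU UV GAH _).2.
under eq_fun do rewrite -mulrA.
by apply: integ_indic iHU; exact: mG.
Qed.

Lemma is_condexpB U1 U2 V1 V2 : integ U1 -> integ U2 ->
  is_condexp P G U1 V1 -> is_condexp P G U2 V2 ->
  is_condexp P G (fun w => U1 w - U2 w) (fun w => V1 w - V2 w).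
Proof.
move=> i1 i2 UV1 UV2; have [G1 j1 _] := UV1; have [G2 j2 _] := UV2.
apply: is_condexpP => //; [exact: integB|exact: measurable_wrtB|exact: integB|].
have iA A W : G A -> integ W -> integ (fun w => \1_A w * W w).
  by move=> /mG; exact: integ_indic.
move=> A GA; under eq_Rintegral do rewrite mulrBr.
under [RHS]eq_Rintegral do rewrite mulrBr.
rewrite !RintegralB//; try exact: iA.
by rewrite (is_condexp_indic UV1 GA) (is_condexp_indic UV2 GA).
Qed.

(** The event on which the order fails belongs to [G], and the integral of the
    nonnegative difference over it is at most zero. *)
Lemma is_condexp_le U U' V V' : integ U -> integ U' ->
  is_condexp P G U V -> is_condexp P G U' V' ->
  {ae P, forall w, U w <= U' w} -> {ae P, forall w, V w <= V' w}.
Proof.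
move=> iU iU' UV UV' UU'; have [GV iV _] := UV; have [GV' iV' _] := UV'.
pose A := [set w | V' w < V w].
have GA : G A.
  have -> : A = (fun w => V w - V' w) @^-1` `]0, +oo[.
    by apply/seteqP; split => w; rewrite /A/= in_itv/= andbT subr_gt0.
  by apply: measurable_wrt_preimage => //; exact: measurable_wrtB.
have iA W : integ W -> integ (fun w => \1_A w * W w) by exact: integ_indic (mG GA).
have D0 w : 0 <= \1_A w * (V w - V' w).
  rewrite indicE; case: (boolP (w \in A)) => [/set_mem|]; rewrite ?mul0r// mul1r.
  by rewrite /A/= subr_ge0 => /ltW.
have iD := iA _ (integB iV iV').
have I0 : \int[P]_w (\1_A w * (V w - V' w)) = 0.
  apply/eqP; rewrite eq_le Rintegral_ge0// andbT.
  have VB := is_condexpB iU iU' UV UV'.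
  rewrite (is_condexp_indic VB GA) (_ : 0 = \int[P]_w (\1_A w * (V w - V' w) * 0)).
    apply: ae_le_Rintegral.
    - exact/iA/integB.
    - by under eq_fun do rewrite mulr0; exact: integ_cst.
    - by apply: filterS UU' => w UUw; rewrite mulr0 mulr_ge0_le0// subr_le0.
  under eq_Rintegral do rewrite mulr0.
  by rewrite /Rintegral integral0.
apply: filterS (Rintegral_ae_eq0 iD D0 I0) => w /eqP.
rewrite mulf_eq0 indicE; case: (boolP (w \in A)) => [_|wA _].
  by rewrite oner_eq0/= subr_eq0 => /eqP ->.
by rewrite leNgt; apply: contra wA => wA; rewrite mem_set.
Qed.

Lemma is_condexp_uniq U V V' : integ U ->
  is_condexp P G U V -> is_condexp P G U V' -> {ae P, forall w, V w = V' w}.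
Proof.
move=> iU UV UV'.
have le1 := is_condexp_le iU iU UV UV' (aeW _ (fun w => lexx (U w))).
have le2 := is_condexp_le iU iU UV' UV (aeW _ (fun w => lexx (U w))).
by apply: filterS2 le1 le2 => w VV' V'V; apply/eqP; rewrite eq_le VV'.
Qed.

Lemma is_condexp_Rintegral U V : is_condexp P G U V ->
  \int[P]_w V w = \int[P]_w U w.
Proof.
move=> [_ _ VU]; congr fine; apply: VU.
by case: sG => G0 GC _; rewrite -(setD0 setT); exact: GC.
Qed.

(** The tangent inequality [|V|^(r-1) |U| <= |U|^r / r + (1 - 1/r) |V|^r] is
    integrated on the event [|V| <= m], where the last term is finite and can be
    subtracted from the left-hand side. *)
Lemma is_condexp_powR_le U V r : 1 < r -> integ U -> is_condexp P G U V ->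
  (\int[P]_w (`|V w| `^ r)%:E <= \int[P]_w (`|U w| `^ r)%:E)%E.
Proof.
move=> r1 iU UV; have [GV iV _] := UV.
have r0 : 0 < r by lra.
have [->|Ufin] := eqVneq (\int[P]_w (`|U w| `^ r)%:E)%E +oo%E; first by rewrite leey.
have mpow W : measurable_fun setT W -> measurable_fun setT (fun w => `|W w| `^ r).
  move=> mW; apply: (measurableT_comp (measurable_powR r)) => //.
  exact: measurableT_comp.
have mU := integ_measurable iU; have mV := integ_measurable iV.
have iUr : integ (fun w => `|U w| `^ r).
  apply/integrableP; split; first exact/measurable_EFinP/mpow.
  under eq_integral do rewrite /= ger0_norm ?powR_ge0//.
  by rewrite ltey.
pose A (m : nat) : set T := [set w | `|V w| <= m%:R].
have GA m : G (A m).
  have -> : A m = (fun w => V w) @^-1` `[- m%:R, m%:R].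
    by apply/seteqP; split => w; rewrite /A/= in_itv/= ler_norml.
  exact: measurable_wrt_preimage.
have GVr s : measurable_wrt G (fun w => `|V w| `^ s).
  apply: (measurable_wrt_comp sG (g := fun x => `|x| `^ s)) => //.
  apply: (measurableT_comp (measurable_powR s)) => //.
have m1 m : measurable_fun setT (\1_(A m) : T -> R).
  by apply: measurable_indic; exact: mG.
have bnd m s w : 0 <= s -> 0 <= \1_(A m) w * `|V w| `^ s <= m%:R `^ s.
  move=> s0; rewrite indicE; case: (boolP (w \in A m)) => [/set_mem wA|_].
    by rewrite mul1r powR_ge0/= ge0_ler_powR// nnegrE.
  by rewrite mul0r lexx powR_ge0.
have absb m s w : 0 <= s -> `|\1_(A m) w * `|V w| `^ s| <= m%:R `^ s.
  by move=> s0; have /andP[? ?] := bnd m s w s0; rewrite ger0_norm.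
have iAV m : integ (fun w => \1_(A m) w * `|V w| `^ r).
  apply: (integ_le _ (integ_cst (m%:R `^ r))).
    by apply: measurable_funM => //; exact: mpow.
  by move=> w; apply: absb; exact: ltW.
apply: (@le_trans _ _ (\int[P]_w `|(`|V w| `^ r)%R|%:E)%E).
  by under [leRHS]eq_integral do rewrite ger0_norm ?powR_ge0//.
apply: (@fatou_norm _ _ _ _ (fun m w => \1_(A m) w * `|V w| `^ r)).
- by move=> m; apply: measurable_funM => //; exact: mpow.
- move=> w; apply: cvg_near_cst; near=> m; rewrite indicE mem_set ?mul1r//.
  by rewrite /A/=; near: m; exact: nbhs_infty_ger.
move=> m; under eq_integral.
  move=> w _; rewrite ger0_norm; last by case/andP: (bnd m r w (ltW r0)).
  over.
rewrite -EFin_Rintegral// -EFin_Rintegral// lee_fin.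
(* The tangent inequality at [|V w|]: [K * V] is the truncated power of [|V|],
   and [K] may be moved from [V] to [U]. *)
pose K w := Num.sg (V w) * (\1_(A m) w * `|V w| `^ (r - 1)).
have r10 : 0 <= r - 1 by lra.
have GK : measurable_wrt G K.
  apply: measurable_wrtM => //; first exact: (measurable_wrt_comp sG (@measurable_sgr R) GV).
  by apply: measurable_wrtM => //; exact: measurable_wrt_indic.
have Kb w : `|K w| <= m%:R `^ (r - 1).
  rewrite normrM (le_trans _ (absb m (r - 1) w r10))// ler_piMl//.
  exact: normr_sg_le1.
have KVU := condexp_pull_bounded sG mG iU UV GK Kb.
have KV w : K w * V w = \1_(A m) w * `|V w| `^ r.
  rewrite /K mulrAC -normrEsg mulrCA; congr (_ * _).
  exact: mulr_powRB1.
have iKU : integ (fun w => K w * U w).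
  exact: (integM_bounded (measurable_wrtW mG GK) Kb iU).
have : \int[P]_w (K w * U w) <= \int[P]_w (r^-1 * `|U w| `^ r +
    (1 - r^-1) * (\1_(A m) w * `|V w| `^ r)).
  apply: le_Rintegral => //.
    by apply: integD; [exact: integZ|exact: (integZ _ (iAV m))].
  move=> w _; rewrite (le_trans (ler_norm _))// normrM /K normrM.
  apply: (@le_trans _ _ (\1_(A m) w * `|V w| `^ (r - 1) * `|U w|)).
    have /andP[b0 _] := bnd m (r - 1) w r10.
    by rewrite ler_wpM2r// [X in _ * X <= _]ger0_norm// ler_piMl// normr_sg_le1.
  rewrite indicE; case: (w \in A m); rewrite ?mul1r ?mul0r ?mulr0 ?addr0.
    by rewrite (mulrC r^-1); exact: young_tangent.
  by rewrite mulr_ge0 ?powR_ge0// invr_ge0 ltW.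
rewrite -KVU; under [in X in X <= _]eq_Rintegral do rewrite KV.
rewrite RintegralD; [|exact: measurableT|exact: integZ|exact: (integZ _ (iAV m))].
rewrite !RintegralZl//; last exact: iAV.
set a := \int[P]_w (_ * _); set b := \int[P]_w _ => ab.
have rV : 0 < r^-1 by rewrite invr_gt0.
have : r^-1 * a <= r^-1 * b by lra.
by rewrite ler_pM2l.
Unshelve. all: by end_near. Qed.

End condexp_properties.

(** * Conditioning on blocks of independent coordinates *)

(** Dynkin's lemma: the sets over which two integrable functions have the same
    integral form a lambda-system. *)
Lemma eq_Rintegral_setI_closed d (T : measurableType d) (R : realType)
    (P : probability T R) (C : set (set T)) (f g : T -> R) :
  C `<=` measurable -> setI_closed C -> integ P f -> integ P g ->
  \int[P]_w f w = \int[P]_w g w ->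
  (forall A, C A -> \int[P]_(w in A) f w = \int[P]_(w in A) g w) ->
  forall A, <<s C >> A -> \int[P]_(w in A) f w = \int[P]_(w in A) g w.
Proof.
move=> mC CI jf jg fgT fgC.
have mS A : <<s C >> A -> measurable A.
  by apply: smallest_sub => //; exact: sigma_algebra_measurable.
have mS' (A : set (g_sigma_algebraType C)) : measurable A -> d.-measurable (A : set T).
  exact: mS.
have intA (h : T -> R) A : d.-measurable A -> integ P h ->
    P.-integrable A (EFin \o h).
  by move=> mA ih; exact: integrableS ih.
apply: (@dynkin_induction _ (g_sigma_algebraType C) C) => //.
- move=> A mA fgA.
  have split (h : T -> R) : integ P h -> \int[P]_w h w =
      \int[P]_(w in A) h w + \int[P]_(w in ~` A) h w.
    move=> ih; rewrite -[in LHS](setUv A) Rintegral_setU ?setUv//.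
    + exact: mS'.
    + by apply: measurableC; exact: mS'.
    + by rewrite disj_set2E setICr.
  by apply: (addrI (\int[P]_(w in A) f w)); rewrite -split// fgA -split.
- move=> F mF tF fgF; congr fine.
  rewrite integral_bigcup//; last 2 first.
  + by move=> k; exact: mS'.
  + by apply: intA => //; apply: bigcup_measurable => k _; exact: mS'.
  rewrite integral_bigcup//; last 2 first.
  + by move=> k; exact: mS'.
  + by apply: intA => //; apply: bigcup_measurable => k _; exact: mS'.
  apply: eq_eseriesr => i _.
  have fin (h : T -> R) : integ P h -> (\int[P]_(w in F i) (h w)%:E)%E \is a fin_num.
    move=> ih; apply: integrable_fin_num; first exact: mS'.
    by apply: intA => //; exact: mS'.
  by rewrite -[LHS]fineK ?fin// -[RHS]fineK ?fin//; congr EFin; exact: fgF.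
Qed.

Section independence.
Context d d' (T : measurableType d) (E : measurableType d') (R : realType).
Variables (P : probability T R) (n : nat) (X : 'I_n -> {RV P >-> E}).
Implicit Types (S : set 'I_n) (A : set T).

Definition rectangle (B : 'I_n -> set E) : set T := [set w | forall i, B i (X i w)].

(** A pi-system generating [sigma_coords X S], on which independence is a product
    formula. *)
Definition cylinders S : set (set T) := [set A | exists B : 'I_n -> set E,
  [/\ forall i, measurable (B i), forall i, ~ S i -> B i = setT & A = rectangle B]].

Lemma rectangleI B1 B2 :
  rectangle B1 `&` rectangle B2 = rectangle (fun i => B1 i `&` B2 i).
Proof.
apply/seteqP; split => [w [w1 w2] i|w w12]; first by split.
by split => i; have [] := w12 i.
Qed.

Lemma cylinders_setI S : setI_closed (cylinders S).
Proof.
move=> _ _ [B1 [m1 S1 ->]] [B2 [m2 S2 ->]]; exists (fun i => B1 i `&` B2 i).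
split; last by rewrite rectangleI.
- by move=> i; exact: measurableI.
- by move=> i Si; rewrite S1// S2// setIT.
Qed.

Lemma sigma_coords_sigma_algebra S : sigma_algebra setT (sigma_coords X S).
Proof. exact: smallest_sigma_algebra. Qed.

Lemma sigma_coords_preimage S i B : S i -> measurable B ->
  sigma_coords X S (X i @^-1` B).
Proof.
by move=> Si mB; apply: sub_sigma_algebra; exists i => //; exists B; rewrite ?setTI.
Qed.

Lemma sigma_coords_sub S S' : S `<=` S' -> sigma_coords X S `<=` sigma_coords X S'.
Proof.
move=> SS'; apply: smallest_sub; first exact: sigma_coords_sigma_algebra.
move=> _ [i Si [B mB <-]]; rewrite setTI.
by apply: sigma_coords_preimage => //; exact: SS'.
Qed.

Lemma sigma_coords_measurable S : sigma_coords X S `<=` measurable.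
Proof.
apply: smallest_sub; first exact: sigma_algebra_measurable.
by move=> _ [i Si [B mB <-]]; exact: measurable_funP.
Qed.

Lemma cylinders_sigma_coords S : cylinders S `<=` sigma_coords X S.
Proof.
move=> _ [B [mB BT ->]].
have -> : rectangle B = \bigcap_(i in [set: 'I_n]) (X i @^-1` B i).
  by apply/seteqP; split => w wB i; [move=> _; exact: wB|exact: (wB i I)].
rewrite -(@measurable_g_measurableTypeE _ _ (sigma_coords_sigma_algebra S)).
apply: fin_bigcap_measurable => // i _.
rewrite measurable_g_measurableTypeE; last exact: sigma_coords_sigma_algebra.
have [Si|Si] := pselect (S i); first exact: sigma_coords_preimage.
rewrite BT// preimage_setT.
have [G0 GC _] := sigma_coords_sigma_algebra S.
by rewrite -(setD0 setT); exact: GC.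
Qed.

Lemma sigma_coordsE S : sigma_coords X S = <<s cylinders S >>.
Proof.
apply/seteqP; split; apply: smallest_sub; try exact: smallest_sigma_algebra.
- move=> _ [i Si [B mB <-]]; rewrite setTI; apply: sub_sigma_algebra.
  exists (fun j => if j == i then B else setT); split.
  + by move=> j; case: ifP.
  + by move=> j Sj; case: eqP => // ji; rewrite ji in Sj.
  + apply/seteqP; split => [w wB j|w /(_ i)]; last by rewrite eqxx.
    by case: eqP => // ->.
- exact: cylinders_sigma_coords.
Qed.

Hypothesis X_indep : mutually_independent X.

Lemma rectangle_prob B : (forall i, measurable (B i)) ->
  (P (rectangle B) = \prod_(i < n) P (X i @^-1` B i))%E.
Proof.
move=> mB; have := X_indep [set: 'I_n]%SET mB.
under eq_bigl do rewrite finset.in_setT.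
move=> <-; congr (P _); apply/seteqP; split => w wB i; first by move=> _; exact: wB.
by apply: wB; rewrite /= finset.in_setT.
Qed.

Lemma cylinders_indep S S' A A' : S `&` S' = set0 -> cylinders S A ->
  cylinders S' A' -> (P (A `&` A') = P A * P A')%E.
Proof.
move=> SS' [B [mB BT ->]] [B' [mB' BT' ->]].
rewrite rectangleI !rectangle_prob//; last by move=> i; exact: measurableI.
rewrite -big_split; apply: eq_bigr => i _ /=.
have [Si|Si] := pselect (S i).
  rewrite (BT' i); first by rewrite setIT preimage_setT probability_setT mule1.
  by move=> S'i; have : (S `&` S') i by []; rewrite SS'.
by rewrite (BT i)// setTI preimage_setT probability_setT mul1e.
Qed.

Lemma condexp_indic_cylinder S S' A : S `&` S' = set0 -> cylinders S' A ->
  is_condexp P (sigma_coords X S) (\1_A : T -> R) (fun=> fine (P A)).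
Proof.
move=> SS' SA.
have mA : measurable A := sigma_coords_measurable (cylinders_sigma_coords SA).
have i1 : integ P (\1_A : T -> R) by exact: integrable_indic.
have ic : integ P (fun _ => fine (P A)) by exact: integ_cst.
have intE C : measurable C -> \int[P]_(w in C) (\1_A w : R) = fine (P (C `&` A)).
  by move=> mC; rewrite /Rintegral integral_indic// setIC.
apply: is_condexpP => //.
- exact: sigma_coords_measurable.
- by apply: measurable_wrt_cst; exact: sigma_coords_sigma_algebra.
rewrite sigma_coordsE => C SC; rewrite !Rintegral_indic.
apply: (eq_Rintegral_setI_closed (C := cylinders S)) => //.
- by move=> D /cylinders_sigma_coords; exact: sigma_coords_measurable.
- exact: cylinders_setI.
- rewrite Rintegral_cst// [X in _ * fine X](probability_setT P) mulr1.
  by rewrite intE// setTI.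
move=> D SD.
have mD : measurable D := sigma_coords_measurable (cylinders_sigma_coords SD).
rewrite Rintegral_cst// intE// (cylinders_indep SS' SD SA).
by rewrite fineM ?fin_num_measure// mulrC.
Qed.

(** Conditioning on two blocks in succession amounts to conditioning on the common
    block: a cylinder over [S'] splits into one over the common block, which
    passes through both conditional expectations, and one over coordinates
    outside [S], which is independent of [V] and of [W]. *)
Lemma is_condexp_setI S S' U V W : integ P U ->
  is_condexp P (sigma_coords X S) U V ->
  is_condexp P (sigma_coords X (S `&` S')) U W ->
  is_condexp P (sigma_coords X S') V W.
Proof.
move=> iU UV UW; have [GV iV _] := UV; have [GW iW _] := UW.
have sG := sigma_coords_sigma_algebra; have mG := @sigma_coords_measurable.
apply: is_condexpP => //.
  by apply: measurable_wrtS GW; apply: sigma_coords_sub => i [].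
have sSI : sigma_coords X (S `&` S') `<=` sigma_coords X S.
  by apply: sigma_coords_sub => i [].
rewrite {1}sigma_coordsE => A SA; rewrite !Rintegral_indic.
apply: (eq_Rintegral_setI_closed (C := cylinders S')) => //.
- by move=> D /cylinders_sigma_coords; exact: mG.
- exact: cylinders_setI.
- rewrite (is_condexp_Rintegral (sG _) UV).
  exact: (is_condexp_Rintegral (sG _) UW).
move=> _ [B [mB BT ->]].
pose B1 i := if pselect (S i) then B i else setT.
pose B2 i := if pselect (S i) then setT else B i.
have -> : rectangle B = rectangle B1 `&` rectangle B2.
  rewrite rectangleI; congr rectangle; apply/funext => i; rewrite /B1 /B2.
  by case: pselect => Si; rewrite ?setIT ?setTI.
have C1 : cylinders (S `&` S') (rectangle B1).
  exists B1; split; [move=> i|move=> i SS'i|by []].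
    by rewrite /B1; case: pselect => Si; [exact: mB|exact: measurableT].
  rewrite /B1; case: pselect => // Si.
  by apply: BT => S'i; exact: SS'i.
have C2 : cylinders (~` S) (rectangle B2).
  exists B2; split; [move=> i|move=> i /contrapT Si|by []].
    by rewrite /B2; case: pselect => Si; [exact: measurableT|exact: mB].
  by rewrite /B2; case: pselect.
have UC := condexp_indic_cylinder (setICr S) C2.
rewrite -(Rintegral_indic P (rectangle B1 `&` rectangle B2) V).
rewrite -(Rintegral_indic P (rectangle B1 `&` rectangle B2) W) indicI.
have pull H : measurable_wrt (sigma_coords X S) H -> integ P H ->
  \int[P]_w ((\1_(rectangle B1) \* \1_(rectangle B2)) w * H w) =
  fine (P (rectangle B2)) * \int[P]_w (\1_(rectangle B1) w * H w).
  move=> GH iH.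
  have S1 : sigma_coords X S (rectangle B1).
    exact: sSI (cylinders_sigma_coords C1).
  have S2 := cylinders_sigma_coords C2.
  have i1H : integ P (fun w => \1_(rectangle B1) w * H w).
    exact: (integ_indic (mG _ _ S1) iH).
  have [] := @condexp_pull _ _ _ _ _ (sG S) (mG S) _ _
    (fun w => \1_(rectangle B1) w * H w) _ UC.
  - exact: integrable_indic (mG _ _ S2).
  - by apply: measurable_wrtM => //; exact: measurable_wrt_indic.
  - under eq_fun do rewrite mulrC.
    exact: (integ_indic (mG _ _ S2) i1H).
  move=> _; rewrite RintegralZr// mulrC => ->.
  by apply: eq_Rintegral => w _ /=; ring.
rewrite !pull//; last exact: measurable_wrtS GW.
congr (_ * _); rewrite (is_condexp_indic UW (cylinders_sigma_coords C1)).
by rewrite (is_condexp_indic UV (sSI _ (cylinders_sigma_coords C1))).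
Qed.

End independence.

(** * Self-adjointness of conditional expectation *)

Section dual_classes.
Context d (T : measurableType d) (R : realType) (P : probability T R).
Local Notation integ := (integ P).
Implicit Types (U V W : T -> R) (A B : set (T -> R)).

Definition condexp_stable (A : set (T -> R)) :=
  forall G U V, sigma_algebra setT G -> G `<=` measurable ->
    is_condexp P G U V -> A U -> A V.

(** The covariance identity is needed both for two square integrable functions and
    for a bounded one against an integrable one. *)
Record dual_classes (A B : set (T -> R)) := {
  dual_integl : A `<=` integ ;
  dual_integr : B `<=` integ ;
  dual_subl : forall U U', A U -> A U' -> A (fun w => U w - U' w) ;
  dual_subr : forall V V', B V -> B V' -> B (fun w => V w - V' w) ;
  dual_stablel : condexp_stable A ;
  dual_stabler : condexp_stable B ;
  dual_integM : forall U V, A U -> B V -> integ (fun w => U w * V w) }.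

(** Both sides are the integral of [V1 * V2]. *)
Lemma condexp_adjoint A B (AB : dual_classes A B) G U V V1 V2 :
  sigma_algebra setT G -> G `<=` measurable -> A U -> B V ->
  is_condexp P G U V1 -> is_condexp P G V V2 ->
  \int[P]_w (V1 w * V w) = \int[P]_w (U w * V2 w).
Proof.
move=> sG mG AU BV UV1 VV2.
have AV1 := dual_stablel AB sG mG UV1 AU.
have BV2 := dual_stabler AB sG mG VV2 BV.
have [G1 _ _] := UV1; have [G2 _ _] := VV2.
have [_ <-] := condexp_pull sG mG (dual_integr AB BV) VV2 G1
  (dual_integM AB AV1 BV).
have iUV2 : integ (fun w => V2 w * U w).
  by under eq_fun do rewrite mulrC; exact: (dual_integM AB AU BV2).
have [_ E] := condexp_pull sG mG (dual_integl AB AU) UV1 G2 iUV2.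
under eq_Rintegral do rewrite mulrC.
by rewrite E; apply: eq_Rintegral => w _; rewrite mulrC.
Qed.

Definition square_integrable : set (T -> R) :=
  [set U : T -> R | measurable_fun setT U /\ integ (fun w => U w ^+ 2)].

Lemma square_integrableM U V : square_integrable U -> square_integrable V ->
  integ (fun w => U w * V w).
Proof.
move=> [mU iU] [mV iV]; apply: (integ_le _ (integD iU iV)).
  exact: measurable_funM.
move=> w; rewrite ler_norml; apply/andP; split; nra.
Qed.

Lemma square_integrable_integ : square_integrable `<=` integ.
Proof.
move=> U U2; have C2 : square_integrable (fun=> 1).
  by split => //; under eq_fun do rewrite expr1n; exact: integ_cst.
have := square_integrableM U2 C2.
by under eq_fun do rewrite mulr1.
Qed.

Lemma square_integrableD U V : square_integrable U -> square_integrable V ->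
  square_integrable (fun w => U w + V w).
Proof.
move=> U2 V2; have [mU iU] := U2; have [mV iV] := V2.
split; first exact: measurable_funD.
have := integD (integD iU (integZ 2 (square_integrableM U2 V2))) iV.
by congr integ; apply/funext => w; ring.
Qed.

Lemma square_integrableZ c U : square_integrable U ->
  square_integrable (fun w => c * U w).
Proof.
move=> [mU iU]; split; first exact: measurable_funM.
have := integZ (c ^+ 2) iU.
by congr integ; apply/funext => w; ring.
Qed.

Lemma square_integrableB U V : square_integrable U -> square_integrable V ->
  square_integrable (fun w => U w - V w).
Proof.
move=> U2 V2; have := square_integrableD U2 (square_integrableZ (-1) V2).
by congr square_integrable; apply/funext => w; rewrite mulN1r.
Qed.

Lemma integ_ge0_lty U : measurable_fun setT U -> (forall w, 0 <= U w) ->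
  (\int[P]_w (U w)%:E < +oo)%E -> integ U.
Proof.
move=> mU U0 Uoo; apply/integrableP; split; first exact/measurable_EFinP.
by under eq_integral do rewrite /= ger0_norm//.
Qed.

Lemma square_integrable_condexp : condexp_stable square_integrable.
Proof.
move=> G U V sG mG UV U2; have iU := square_integrable_integ U2.
have [GV iV _] := UV; have mV := integ_measurable iV.
split => //; apply: integ_ge0_lty.
- exact: measurable_funX.
- by move=> w; exact: sqr_ge0.
have := is_condexp_powR_le sG mG (ltr1n R 2) iU UV.
have sqE (x : R) : `|x| `^ 2 = x ^+ 2.
  by rewrite -[2]/(2%:R) powR_mulrn// real_normK// num_real.
under eq_integral do rewrite sqE.
under [leRHS]eq_integral do rewrite sqE.
move=> /le_lt_trans; apply.
by rewrite -EFin_Rintegral ?ltry//; case: U2.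
Qed.

Lemma dual_square_integrable : dual_classes square_integrable square_integrable.
Proof.
split; try exact: square_integrable_integ; try exact: square_integrableB;
  try exact: square_integrable_condexp; exact: square_integrableM.
Qed.

Definition ae_bounded : set (T -> R) :=
  [set U : T -> R | measurable_fun setT U /\ exists M, {ae P, forall w, `|U w| <= M}].

Lemma ae_bounded_integ : ae_bounded `<=` integ.
Proof. by move=> U [mU [M UM]]; exact: integ_ae_le mU (integ_cst P M) UM. Qed.

Lemma dual_bounded_integ : dual_classes ae_bounded integ.
Proof.
split => //.
- exact: ae_bounded_integ.
- move=> U U' [mU [M UM]] [mU' [M' UM']]; split; first exact: measurable_funB.
  exists (M + M'); apply: filterS2 UM UM' => w UM UM'.
  by rewrite (le_trans (ler_normB _ _))// lerD.
- by move=> *; exact: integB.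
- move=> G U V sG mG UV UB; have iU := ae_bounded_integ UB.
  have [mU [M UM]] := UB; have [GV iV _] := UV.
  split; first exact: integ_measurable iV.
  exists M.
  have cM (c : R) : is_condexp P G (fun=> c) (fun=> c).
    by apply: is_condexp_id => //; [exact: measurable_wrt_cst|exact: integ_cst].
  have le1 : {ae P, forall w, V w <= M}.
    apply: (is_condexp_le sG mG iU (integ_cst P M) UV (cM M)).
    by apply: filterS UM => w; rewrite ler_norml => /andP[].
  have le2 : {ae P, forall w, - M <= V w}.
    apply: (is_condexp_le sG mG (integ_cst P (- M)) iU (cM (- M)) UV).
    by apply: filterS UM => w; rewrite ler_norml => /andP[].
  by apply: filterS2 le1 le2 => w VM MV; rewrite ler_norml VM MV.
- by move=> G U V sG mG [].
- by move=> U V [mU [M UM]] iV; exact: (integM_ae_bounded mU UM).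
Qed.

End dual_classes.

(** * The covariance identity *)

Section covariance.
Context d d' (T : measurableType d) (E : measurableType d') (R : realType).
Variables (P : probability T R) (n : nat) (X : 'I_n -> {RV P >-> E}).
Hypothesis X_indep : mutually_independent X.
Local Notation integ := (integ P).
Local Notation sX := (sigma_coords X).
Implicit Types (S : set 'I_n) (U V W : T -> R).

Let sG S := sigma_coords_sigma_algebra X S.
Let mG S := @sigma_coords_measurable _ _ _ _ _ _ _ X S.

Lemma condexp_coordsP S U : integ U -> is_condexp P (sX S) U (condexp P (sX S) U).
Proof. by move=> iU; exact: is_condexp_condexp. Qed.

Lemma condexp_coords_integ S U : integ U -> integ (condexp P (sX S) U).
Proof. by move=> iU; have [] := condexp_coordsP S iU. Qed.

Lemma Dcoord_integ k U : integ U -> integ (Dcoord X k U).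
Proof. by move=> iU; apply: integB => //; exact: condexp_coords_integ. Qed.

Lemma is_condexp_set0 U : integ U -> is_condexp P (sX set0) U (fun=> \int[P]_w U w).
Proof.
move=> iU; apply: is_condexpP => //; [exact: measurable_wrt_cst|exact: integ_cst|].
rewrite sigma_coordsE => A SA; rewrite !Rintegral_indic.
have cstE : \int[P]_w (\int[P]_w U w) = \int[P]_w U w.
  by rewrite Rintegral_cst// [X in _ * fine X](probability_setT P) mulr1.
apply: (eq_Rintegral_setI_closed (C := cylinders X set0)) => //.
- by move=> D /cylinders_sigma_coords; exact: mG.
- exact: cylinders_setI.
- exact: integ_cst.
move=> _ [B [_ BT ->]].
suff -> : rectangle X B = setT by [].
by apply/seteqP; split => // w _ i; rewrite BT.
Qed.

(** Integrating out [X k] and then conditioning on [S'] is conditioning on [S], so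
    [Dcoord X k V] is seen from [S'] as a martingale increment. *)
Lemma condexp_Dcoord S S' k V : integ V -> ~ S k -> S' = S `|` [set k] ->
  is_condexp P (sX S') (Dcoord X k V)
    (fun w => condexp P (sX S') V w - condexp P (sX S) V w).
Proof.
move=> iV Sk S'E; apply: is_condexpB => //; [exact: condexp_coords_integ|
  exact: condexp_coordsP|].
apply: (is_condexp_setI X_indep iV (condexp_coordsP _ iV)).
suff -> : [set j | j != k] `&` S' = S by exact: condexp_coordsP.
rewrite S'E; apply/seteqP; split => j /=.
  by move=> [/eqP jk [//|/jk]].
by move=> Sj; split; [apply/eqP => jk; rewrite jk in Sj|left].
Qed.

(** Of the four products obtained by expanding both differences, the two that
    involve the [k]-th conditional expectation of [U] cancel: it is moved onto
    the other factor, where it turns both [S'] and [S] into [S]. *)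
Lemma integral_Dcoord_condexp A B (AB : dual_classes P A B) S S' k U V :
  A U -> B V -> ~ S k -> S' = S `|` [set k] ->
  \int[P]_w (Dcoord X k U w * condexp P (sX S') (Dcoord X k V) w) =
  \int[P]_w (U w * condexp P (sX S') V w) - \int[P]_w (U w * condexp P (sX S) V w).
Proof.
move=> AU BV Sk S'E.
have iU := dual_integl AB AU; have iV := dual_integr AB BV.
have DV := condexp_Dcoord iV Sk S'E.
have iDV := Dcoord_integ k iV; have iDU := Dcoord_integ k iU.
have cB Q W : B W -> B (condexp P (sX Q) W).
  move=> BW; have iW := dual_integr AB BW.
  exact: (dual_stabler AB (sG Q) (@mG Q) (condexp_coordsP Q iW)).
have cA Q W : A W -> A (condexp P (sX Q) W).
  move=> AW; have iW := dual_integl AB AW.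
  exact: (dual_stablel AB (sG Q) (@mG Q) (condexp_coordsP Q iW)).
set Ek := condexp P (sX [set j | j != k]) U.
have Sk' : S `&` [set j | j != k] = S.
  by rewrite setIidl// => j Sj /=; apply/eqP => jk; rewrite jk in Sj.
have S'k : S' `&` [set j | j != k] = S.
  rewrite S'E setIUl Sk'; apply/seteqP; split => j; last by left.
  by move=> [//|[-> /=]]; rewrite eqxx.
have adj Q : Q `&` [set j | j != k] = S ->
    \int[P]_w (Ek w * condexp P (sX Q) V w) = \int[P]_w (U w * condexp P (sX S) V w).
  move=> QS; apply: (condexp_adjoint AB (sG _) (@mG _) AU (cB Q V BV)).
    exact: condexp_coordsP.
  apply: (is_condexp_setI X_indep iV (condexp_coordsP Q iV)).
  by rewrite QS; exact: condexp_coordsP.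
transitivity (\int[P]_w (Dcoord X k U w *
    (condexp P (sX S') V w - condexp P (sX S) V w))).
  apply: ae_eq_Rintegral.
  - apply: measurable_funM; first exact: integ_measurable iDU.
    exact: integ_measurable (condexp_coords_integ S' iDV).
  - apply: measurable_funM; first exact: integ_measurable iDU.
    by apply: measurable_funB; apply: integ_measurable; exact: condexp_coords_integ.
  - have := is_condexp_uniq (sG _) (@mG _) iDV (condexp_coordsP S' iDV) DV.
    by apply: filterS => w ->.
have M1 Q : integ (fun w => U w * condexp P (sX Q) V w).
  exact: (dual_integM AB AU (cB Q V BV)).
have M2 Q : integ (fun w => Ek w * condexp P (sX Q) V w).
  exact: (dual_integM AB (cA _ U AU) (cB Q V BV)).
transitivity (\int[P]_w ((U w * condexp P (sX S') V w - U w * condexp P (sX S) V w)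
   - (Ek w * condexp P (sX S') V w - Ek w * condexp P (sX S) V w))).
  by apply: eq_Rintegral => w _; rewrite /Dcoord /Ecoord -/Ek; ring.
rewrite RintegralB//; [|exact: (integB (M1 _) (M1 _))|exact: (integB (M2 _) (M2 _))].
rewrite RintegralB//; [|exact: M1|exact: M1].
rewrite RintegralB//; [|exact: M2|exact: M2].
by rewrite (adj S' S'k) (adj S Sk') subrr subr0.
Qed.

(** The increments telescope from the mean of [V] to [V] itself. *)
Lemma sum_integral_past A B (AB : dual_classes P A B) U V :
  A U -> B V -> measurable_wrt (sX setT) V ->
  \sum_(k < n) \int[P]_w (Dcoord X k U w * condexp P (past X k) (Dcoord X k V) w) =
  \int[P]_w (U w * V w) - \int[P]_w U w * \int[P]_w V w.
Proof.
move=> AU BV GV; have iU := dual_integl AB AU; have iV := dual_integr AB BV.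
pose S (m : nat) : set 'I_n := [set i | (i < m)%N].
pose a m := \int[P]_w (U w * condexp P (sX (S m)) V w).
have inc (k : 'I_n) : \int[P]_w (Dcoord X k U w *
    condexp P (past X k) (Dcoord X k V) w) = a k.+1 - a k.
  apply: (integral_Dcoord_condexp AB AU BV); first by rewrite /S/= ltnn.
  apply/seteqP; split => j /=; rewrite /S/=.
    rewrite leq_eqVlt => /orP[/eqP jk|]; last by left.
    by right; exact: val_inj.
  by move=> -[/ltnW//|->].
rewrite (eq_bigr (fun k : 'I_n => a k.+1 - a k)) => [|k _]; last exact: inc.
rewrite -(big_mkord xpredT (fun k => a k.+1 - a k)) telescope_sumr//.
have mC Q : measurable_fun setT (condexp P (sX Q) V).
  by apply: integ_measurable; exact: condexp_coords_integ.
have mU := integ_measurable iU; have mV := integ_measurable iV.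
congr (_ - _).
- have ST : S n = setT by apply/seteqP; split => // i _; exact: ltn_ord.
  rewrite /a ST; apply: ae_eq_Rintegral; [exact: measurable_funM..|].
  have := is_condexp_uniq (sG _) (@mG _) iV (condexp_coordsP setT iV)
    (is_condexp_id (@mG _) GV iV).
  by apply: filterS => w ->.
- have S0 : S 0%N = set0 by apply/seteqP; split.
  rewrite /a S0 -RintegralZr//; apply: ae_eq_Rintegral; [exact: measurable_funM..|].
  have := is_condexp_uniq (sG _) (@mG _) iV (condexp_coordsP set0 iV)
    (is_condexp_set0 iV).
  by apply: filterS => w ->.
Qed.

Lemma sum_integral_future A B (AB : dual_classes P A B) U V :
  A U -> B V -> measurable_wrt (sX setT) V ->
  \sum_(k < n) \int[P]_w (Dcoord X k U w * condexp P (future X k) (Dcoord X k V) w) =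
  \int[P]_w (U w * V w) - \int[P]_w U w * \int[P]_w V w.
Proof.
move=> AU BV GV; have iU := dual_integl AB AU; have iV := dual_integr AB BV.
pose S (m : nat) : set 'I_n := [set i | (m <= i)%N].
pose a m := \int[P]_w (U w * condexp P (sX (S m)) V w).
have inc (k : 'I_n) : \int[P]_w (Dcoord X k U w *
    condexp P (future X k) (Dcoord X k V) w) = - (a k.+1 - a k).
  rewrite opprB; apply: (integral_Dcoord_condexp AB AU BV); first by rewrite /S/= ltnn.
  apply/seteqP; split => j /=; rewrite /S/=.
    rewrite leq_eqVlt => /orP[/eqP kj|]; last by left.
    by right; exact/esym/val_inj.
  by move=> -[/ltnW//|->].
rewrite (eq_bigr (fun k : 'I_n => - (a k.+1 - a k))) => [|k _]; last exact: inc.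
rewrite sumrN -(big_mkord xpredT (fun k => a k.+1 - a k)) telescope_sumr// opprB.
have mC Q : measurable_fun setT (condexp P (sX Q) V).
  by apply: integ_measurable; exact: condexp_coords_integ.
have mU := integ_measurable iU; have mV := integ_measurable iV.
congr (_ - _).
- have ST : S 0%N = setT by apply/seteqP; split.
  rewrite /a ST; apply: ae_eq_Rintegral; [exact: measurable_funM..|].
  have := is_condexp_uniq (sG _) (@mG _) iV (condexp_coordsP setT iV)
    (is_condexp_id (@mG _) GV iV).
  by apply: filterS => w ->.
- have S0 : S n = set0.
    by apply/seteqP; split => // i; rewrite /S/= leqNgt ltn_ord.
  rewrite /a S0 -RintegralZr//; apply: ae_eq_Rintegral; [exact: measurable_funM..|].
  have := is_condexp_uniq (sG _) (@mG _) iV (condexp_coordsP set0 iV)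
    (is_condexp_set0 iV).
  by apply: filterS => w ->.
Qed.

Lemma covariance_Dcoord A B (AB : dual_classes P A B) alpha U V :
  A U -> B V -> measurable_wrt (sX setT) V ->
  \sum_(k < n) \int[P]_w (Dcoord X k U w * Dcoord_mix X alpha k V w) =
  \int[P]_w (U w * V w) - \int[P]_w U w * \int[P]_w V w.
Proof.
move=> AU BV GV.
have iU := dual_integl AB AU; have iV := dual_integr AB BV.
have cB Q W : B W -> B (condexp P (sX Q) W).
  move=> BW; have iW := dual_integr AB BW.
  exact: (dual_stabler AB (sG Q) (@mG Q) (condexp_coordsP Q iW)).
have cA Q W : A W -> A (condexp P (sX Q) W).
  move=> AW; have iW := dual_integl AB AW.
  exact: (dual_stablel AB (sG Q) (@mG Q) (condexp_coordsP Q iW)).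
have ADU k : A (Dcoord X k U) by apply: (dual_subl AB) => //; exact: cA.
have BDV k : B (Dcoord X k V) by apply: (dual_subr AB) => //; exact: cB.
have iM Q k : integ (fun w => Dcoord X k U w * condexp P (sX Q) (Dcoord X k V) w).
  by apply: (dual_integM AB) => //; exact: cB.
transitivity (\sum_(k < n)
   (alpha * \int[P]_w (Dcoord X k U w * condexp P (past X k) (Dcoord X k V) w)
   + (1 - alpha) * \int[P]_w (Dcoord X k U w * condexp P (future X k) (Dcoord X k V) w))).
  apply: eq_bigr => k _.
  rewrite -RintegralZl//; last exact: iM.
  rewrite -RintegralZl//; last exact: iM.
  rewrite -RintegralD//; [|exact/integZ/iM|exact/integZ/iM].
  by apply: eq_Rintegral => w _; rewrite /Dcoord_mix; ring.
rewrite big_split/= -!mulr_sumr (sum_integral_past AB)// (sum_integral_future AB)//.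
by ring.
Qed.

End covariance.

(** * Calculus on the line *)

Section calculus.
Variable R : realType.
Implicit Types (f g u : R -> R) (x y z a b : R).

(** The differentiation rules are restated for functions written pointwise, so that
    the derivative of an explicit expression is found by unification. *)
Lemma is_derive_add f g x a b : is_derive x 1 f a -> is_derive x 1 g b ->
  is_derive x 1 (fun y => f y + g y) (a + b).
Proof. exact: is_deriveD. Qed.

Lemma is_derive_sub f g x a b : is_derive x 1 f a -> is_derive x 1 g b ->
  is_derive x 1 (fun y => f y - g y) (a - b).
Proof. exact: is_deriveB. Qed.

Lemma is_derive_mul f g x a b : is_derive x 1 f a -> is_derive x 1 g b ->
  is_derive x 1 (fun y => f y * g y) (f x * b + g x * a).
Proof. exact: is_deriveM. Qed.

Lemma is_derive_inv f x a : f x != 0 -> is_derive x 1 f a ->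
  is_derive x 1 (fun y => (f y)^-1) (- (f x) ^- 2 * a).
Proof.
move=> fx0 [df fa]; split; first exact: derivableV.
by rewrite deriveV// fa.
Qed.

Lemma is_derive_const (c : R) x : is_derive x 1 (fun _ : R => c) 0.
Proof. exact: is_derive_cst. Qed.

Lemma is_derive_idfun x : is_derive x 1 (fun y : R => y) 1.
Proof. exact: is_derive_id. Qed.

Lemma is_derive_continuous f x a : is_derive x 1 f a -> {for x, continuous f}.
Proof.
by move=> [df _]; apply: differentiable_continuous; apply/derivable1_diffP.
Qed.

Lemma mean_value f (df : R -> R) x y : (forall z, is_derive z 1 f (df z)) ->
  exists2 c, Num.min x y <= c <= Num.max x y & f y - f x = df c * (y - x).
Proof.
move=> fd.
have cf z w : {within `[z, w], continuous f}.
  by apply: derivable_within_continuous => t _; have [] := fd t.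
have [xy|yx] := leP x y.
  have [c] := MVT_segment xy (fun z _ => fd z) (@cf x y).
  by rewrite in_itv/= => xcy E; exists c.
have [c] := MVT_segment (ltW yx) (fun z _ => fd z) (@cf y x).
rewrite in_itv/= => ycx E; exists c => //.
by rewrite -[LHS]opprB E -mulrN opprB.
Qed.

Lemma ler_of_derive_le f (df : R -> R) M x y : (forall z, is_derive z 1 f (df z)) ->
  x <= y -> (forall z, x <= z <= y -> df z <= M) -> f y - f x <= M * (y - x).
Proof.
move=> fd xy dM; have [c] := mean_value x y fd.
rewrite min_l// max_r// => xcy ->; rewrite ler_wpM2r ?subr_ge0//.
exact: dM.
Qed.

(** A function that vanishes at an infinite end and decreases away from it is
    nonpositive. *)
Lemma le0_of_cvg_left u (du : R -> R) x : (forall z, is_derive z 1 u (du z)) ->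
  (forall z, z <= x -> du z <= 0) -> (fun n => u (- n%:R)) @ \oo --> 0 -> u x <= 0.
Proof.
move=> ud du0 u0; rewrite -(cvg_lim (@Rhausdorff R) u0).
apply: limr_ge; first exact: cvgP u0.
near=> n.
have nx : - n%:R <= x.
  by rewrite lerNl; near: n; exact: nbhs_infty_ger.
rewrite -subr_le0 -[leRHS](mul0r (x - (- n%:R))).
by apply: (ler_of_derive_le ud) => // z /andP[_]; exact: du0.
Unshelve. all: by end_near. Qed.

Lemma le0_of_cvg_right u (du : R -> R) x : (forall z, is_derive z 1 u (du z)) ->
  (forall z, x <= z -> 0 <= du z) -> (fun n => u n%:R) @ \oo --> 0 -> u x <= 0.
Proof.
move=> ud du0 u0; rewrite -(cvg_lim (@Rhausdorff R) u0).
apply: limr_ge; first exact: cvgP u0.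
near=> n.
have nx : x <= n%:R by near: n; exact: nbhs_infty_ger.
have [c] := mean_value x n%:R ud; rewrite min_l// max_r// => /andP[xc _] E.
by rewrite -subr_ge0 E mulr_ge0 ?subr_ge0// du0.
Unshelve. all: by end_near. Qed.

End calculus.

(** * The Gaussian density *)

Section gaussian_density.
Variable R : realType.
Implicit Types x y : R.

Definition gauss (x : R) : R := normal_pdf 0 1 x.
Local Notation mu := (@lebesgue_measure R).

Lemma gaussE x : gauss x = normal_peak 1 * expR (- x ^+ 2 / 2).
Proof.
rewrite /gauss normal_pdfE ?oner_eq0// /normal_fun subr0 expr1n.
by rewrite mulr2n.
Qed.

Lemma gauss_gt0 x : 0 < gauss x.
Proof. by rewrite gaussE mulr_gt0 ?expR_gt0// normal_peak_gt0 ?oner_eq0. Qed.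

Lemma gauss_ge0 x : 0 <= gauss x. Proof. exact/ltW/gauss_gt0. Qed.

Lemma normal_peak1_le : normal_peak 1 <= 2^-1 :> R.
Proof.
rewrite /normal_peak expr1n mul1r lef_pV2 ?posrE//; last first.
  by rewrite sqrtr_gt0 mulrn_wgt0// pi_gt0.
rewrite -[leLHS]ger0_norm// -sqrtr_sqr ler_wsqrtr// -mulr_natr.
by have := pi_ge2 R; rewrite expr2; lra.
Qed.

Lemma gauss_le_half x : gauss x <= 2^-1.
Proof.
apply: le_trans normal_peak1_le; rewrite gaussE ler_piMr//.
  by rewrite normal_peak_ge0.
by rewrite -expR0 ler_expR mulNr oppr_le0 divr_ge0// sqr_ge0.
Qed.

Lemma gauss_sym x : gauss (- x) = gauss x.
Proof. by rewrite !gaussE sqrrN. Qed.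

Lemma is_derive_gauss x : is_derive x 1 gauss (- x * gauss x).
Proof.
have -> : gauss = (fun y => normal_peak 1 * (expR \o (fun z => - (2^-1) * (z * z))) y).
  by apply/funext => y; rewrite gaussE /= expr2; congr (_ * expR _); ring.
have d0 := is_derive_mul (is_derive_idfun x) (is_derive_idfun x).
have d1 := is_derive_mul (is_derive_const (- 2^-1) x) d0.
have d2 := is_derive_mul (is_derive_const (normal_peak 1) x)
  (is_derive1_comp (is_derive_expR _) d1).
by apply: (is_derive_eq d2); rewrite /=; field.
Qed.

Lemma continuous_gauss : continuous gauss.
Proof. by move=> x; exact: is_derive_continuous (is_derive_gauss x). Qed.

(** From [exp (x^2/2) >= (1 + x^2/4)^2]. *)
Lemma gauss_decay x : gauss x * (1 + x ^+ 2) ^+ 2 <= 8.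
Proof.
have E : (1 + x ^+ 2 / 4) ^+ 2 <= expR (x ^+ 2 / 2).
  have -> : expR (x ^+ 2 / 2) = expR (x ^+ 2 / 4) ^+ 2.
    by rewrite -expRM_natl; congr expR; field.
  by apply: lerXn2r; rewrite ?nnegrE ?expR_ge0 ?expR_ge1Dx// addr_ge0// divr_ge0// sqr_ge0.
have -> : 8 = 2^-1 * 16 :> R by lra.
rewrite gaussE -mulrA; apply: ler_pM; rewrite ?normal_peak_ge0//.
- by rewrite mulr_ge0 ?expR_ge0// sqr_ge0.
- exact: normal_peak1_le.
rewrite mulNr expRN mulrC ler_pdivrMr ?expR_gt0//.
by apply: le_trans (ler_wpM2l _ E) => //; have := sqr_ge0 x; nra.
Qed.

(** The sign [(-1) ^+ s] selects the end of the line. *)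
Lemma cvg_gauss_poly (g : R -> R) (s : bool) : (forall x, `|g x| <= 1 + x ^+ 2) ->
  (fun n => g ((-1) ^+ s * n%:R) * gauss ((-1) ^+ s * n%:R)) @ \oo --> 0.
Proof.
move=> g2.
have cv : (fun n => 8 * (n%:R ^-1 : R)) @ \oo --> 0.
  rewrite -[X in _ --> X](mulr0 8); apply: cvgMr.
  apply/gtr0_cvgV0; last exact: cvgr_idn.
  by near=> n; rewrite ltr0n; near: n; exact: nbhs_infty_gt.
apply/norm_cvg0P.
apply: (squeeze_cvgr (f := fun=> 0) (h := fun n : nat => 8 * (n%:R ^-1 : R)) _ _ cv); last exact: cvg_cst.
near=> n; rewrite normr_ge0/=.
set x := _ * n%:R.
have xn : x ^+ 2 = n%:R ^+ 2 by rewrite exprMn sqrr_sign mul1r.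
have n0 : 0 < n%:R :> R by rewrite ltr0n; near: n; exact: nbhs_infty_gt.
rewrite ler_pdivlMr// normrM (ger0_norm (gauss_ge0 _)).
apply: le_trans (gauss_decay x).
rewrite mulrAC mulrC ler_wpM2l ?gauss_ge0//.
apply: (@le_trans _ _ ((1 + x ^+ 2) * (1 + x ^+ 2))); last by rewrite expr2.
by apply: ler_pM => //; rewrite xn; nra.
Unshelve. all: by end_near. Qed.

Lemma cvg_gauss_left (g : R -> R) : (forall x, `|g x| <= 1 + x ^+ 2) ->
  (fun n => g (- n%:R) * gauss (- n%:R)) @ \oo --> 0.
Proof. by move=> /(cvg_gauss_poly true); under eq_fun do rewrite mulN1r. Qed.

Lemma cvg_gauss_right (g : R -> R) : (forall x, `|g x| <= 1 + x ^+ 2) ->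
  (fun n => g n%:R * gauss n%:R) @ \oo --> 0.
Proof. by move=> /(cvg_gauss_poly false); under eq_fun do rewrite mul1r. Qed.

Lemma integrable_gauss : mu.-integrable setT (EFin \o gauss).
Proof. exact: integrable_normal_pdf. Qed.

Lemma Rintegral_gauss : \int[mu]_x gauss x = 1.
Proof. by rewrite /Rintegral integral_normal_pdf. Qed.

End gaussian_density.

(** * Lower bounds for the Gaussian distribution function *)

Section primitive.
Variable R : realType.
Local Notation mu := (@lebesgue_measure R).

(** Dominated convergence gives the limits at both ends, which are the boundary
    conditions of all the comparison arguments below. *)
Lemma primitive_on_line (g : R -> R) : continuous g ->
  mu.-integrable setT (EFin \o g) ->
  exists u : R -> R, [/\ forall x : R, is_derive x 1 u (g x),
    (fun n => u (- n%:R)) @ \oo --> 0 &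
    (fun n => u n%:R) @ \oo --> \int[mu]_x g x].
Proof.
move=> cg ig; pose u x := \int[mu]_(t in `]-oo, x]) g t.
have ug (x : R) : is_derive x 1 u (g x).
  have xx1 : x < x + 1 by rewrite ltrDl.
  have ig' : mu.-integrable `]-oo, x + 1] (EFin \o g).
    by apply: integrableS ig => //; exact: measurable_itv.
  have [du u'] := @continuous_FTC1 R g -oo%O x (x + 1) xx1 ig' (ltNyr _) (cg x).
  by split; [exact: du|rewrite -derive1E; exact: u'].
have uE x : u x = \int[mu]_t (g t * \1_`]-oo, x] t).
  rewrite /u Rintegral_mkcond; apply: eq_Rintegral => t _.
  by rewrite patchE indicE; case: ifP; rewrite ?mulr1 ?mulr0.
have mg := integ_measurable ig.
have dom (x_ : nat -> R) (l : R -> R) : measurable_fun setT l ->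
    (forall t, (fun n => g t * \1_`]-oo, x_ n] t) @ \oo --> l t) ->
    (fun n => u (x_ n)) @ \oo --> \int[mu]_t l t.
  move=> ml gl.
  have -> : (fun n => u (x_ n)) = (fun n => \int[mu]_t (g t * \1_`]-oo, x_ n] t)).
    by apply/funext => n; exact: uE.
  apply: (@dominated_Rintegral_cvg _ _ R mu (fun n t => g t * \1_`]-oo, x_ n] t) l (fun t => `|g t|)) => //.
  - by move=> n; apply: measurable_funM => //; exact: measurable_indic.
  - exact: integ_norm.
  - move=> n t; rewrite normrM ler_piMr// indicE.
    by case: (t \in _); rewrite ?normr1 ?normr0.
exists u; split => //.
- rewrite (_ : 0 = \int[mu]_t (0 : R)); last by rewrite /Rintegral integral0.
  apply: (dom (fun n => - n%:R) (fun=> 0)) => // t.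
  apply: cvg_near_cst; near=> n; rewrite indicE memNset ?mulr0//= in_itv/=.
  apply/negP; rewrite -ltNge ltrNl; near: n; exact: nbhs_infty_gtr.
- apply: (dom (fun n => n%:R) g) => // t.
  apply: cvg_near_cst; near=> n; rewrite indicE mem_set ?mulr1//= in_itv/=.
  by near: n; exact: nbhs_infty_ger.
Unshelve. all: by end_near. Qed.

End primitive.

Section gaussian_tail.
Variable R : realType.
Variable Phi : R -> R.
Hypothesis dPhi : forall x : R, is_derive x 1 Phi (gauss x).
Hypothesis PhiN : (fun n => Phi (- n%:R)) @ \oo --> 0.
Implicit Types x z : R.

Lemma gauss_cdf_ge0 x : 0 <= Phi x.
Proof.
rewrite -oppr_le0; apply: (le0_of_cvg_left (fun z => is_deriveN (dPhi z))).
  by move=> z _; rewrite oppr_le0 gauss_ge0.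
by have H := cvgN PhiN; rewrite oppr0 in H; exact: H.
Qed.

Let gaussN : (fun n => gauss (- n%:R) : R) @ \oo --> 0.
Proof.
have b1 : forall z : R, `|1 : R| <= 1 + z ^+ 2 by move=> z; rewrite normr1 lerDl sqr_ge0.
by have := cvg_gauss_left b1; under eq_fun do rewrite mul1r.
Qed.

Let xgaussN : (fun n => - n%:R * gauss (- n%:R) : R) @ \oo --> 0.
Proof.
apply: (@cvg_gauss_left R id) => x.
by have := normr_ge0 x; rewrite -(real_normK (num_real x)); nra.
Qed.

(** [x * Phi x + gauss x] is the primitive of [Phi] that vanishes at minus
    infinity. *)
Lemma gauss_cdf_primitive_ge0 x : x <= 0 -> 0 <= x * Phi x + gauss x.
Proof.
rewrite le_eqVlt => /predU1P[->|x0]; first by rewrite mul0r add0r gauss_ge0.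
suff H : Phi x + x^-1 * gauss x <= 0.
  have := mulr_le0 (ltW x0) H; rewrite mulrDr mulrA divff ?mul1r//.
  by rewrite lt_eqF.
apply: (le0_of_cvg_left (u := fun z => Phi z + x^-1 * gauss z)
  (du := fun z => gauss z * (1 - z / x))).
- move=> z; have d1 := is_derive_mul (is_derive_const x^-1 z) (is_derive_gauss z).
  by apply: (is_derive_eq (is_derive_add (dPhi z) d1)); ring.
- move=> z zx.
  rewrite mulr_ge0_le0 ?gauss_ge0// subr_le0.
  by rewrite ler_ndivlMr// mul1r.
- have H := cvgD PhiN (cvgM (cvg_cst x^-1) gaussN).
  by rewrite mulr0 addr0 in H; exact: H.
Qed.

(** Twice the integral of the previous quantity, hence the second moment of the
    positive part of [x - N]. *)
Let mills x : x <= 0 -> 0 <= Phi x * (1 + x ^+ 2) + x * gauss x.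
Proof.
move=> x0; rewrite -oppr_le0.
apply: (le0_of_cvg_left (u := fun z => - (Phi z * (1 + z * z) + z * gauss z))
  (du := fun z => - (2 * (z * Phi z + gauss z)))); last first.
- have cvP : (fun n => Phi (- n%:R) * (1 + (- n%:R) * (- n%:R))) @ \oo --> 0.
    have bnd : forall x : R, `|1 + x ^+ 2| <= 1 + x ^+ 2.
      by move=> z; rewrite ger0_norm// addr_ge0// sqr_ge0.
    apply: (squeeze_cvgr _ (cvg_cst 0) (cvg_gauss_left bnd)).
    near=> n; have n1 : 1 <= n%:R :> R by rewrite ler1n; near: n; exact: nbhs_infty_gt.
    rewrite -expr2 mulr_ge0 ?gauss_cdf_ge0 ?addr_ge0 ?sqr_ge0//= mulrC.
    rewrite ler_wpM2l ?addr_ge0 ?sqr_ge0//.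
    have nN : - n%:R <= 0 :> R by rewrite oppr_le0.
    have := gauss_cdf_primitive_ge0 nN; have := gauss_cdf_ge0 (- n%:R).
    nra.
  have H := cvgN (cvgD cvP xgaussN).
  by rewrite addr0 oppr0 in H; exact: H.
- move=> z zx; rewrite oppr_le0 mulr_ge0// gauss_cdf_primitive_ge0//.
  exact: le_trans x0.
- move=> z; have dz := is_derive_idfun z.
  have d1 := is_derive_mul (dPhi z) (is_derive_add (is_derive_const 1 z) (is_derive_mul dz dz)).
  have d2 := is_derive_mul dz (is_derive_gauss z).
  by apply: (is_derive_eq (is_deriveN (is_derive_add d1 d2))); ring.
Unshelve. all: by end_near. Qed.

(** Cauchy--Schwarz for the moments of order 0, 1, 2 of the positive part of
    [x - N]; equivalently Birnbaum's lower bound for the Mills ratio. *)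
Lemma gauss_cdf_birnbaum x : x <= 0 ->
  gauss x * (x * Phi x + gauss x) <= Phi x ^+ 2.
Proof.
move=> x0.
suff : gauss x * (x * Phi x + gauss x) - Phi x * Phi x <= 0.
  by rewrite expr2 subr_le0.
apply: (le0_of_cvg_left (u := fun z => gauss z * (z * Phi z + gauss z) - Phi z * Phi z)
  (du := fun z => - (gauss z * (Phi z * (1 + z ^+ 2) + z * gauss z)))).
- move=> z; have dz := is_derive_idfun z; have dg := is_derive_gauss z.
  have d1 := is_derive_mul dg (is_derive_add (is_derive_mul dz (dPhi z)) dg).
  have d2 := is_derive_mul (dPhi z) (dPhi z).
  by apply: (is_derive_eq (is_derive_sub d1 d2)); ring.
- move=> z zx; rewrite oppr_le0 mulr_ge0 ?gauss_ge0// mills//.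
  exact: le_trans x0.
- have H := cvgB (cvgD (cvgM xgaussN PhiN) (cvgM gaussN gaussN)) (cvgM PhiN PhiN).
  rewrite !mulr0 addr0 subr0 in H.
  under eq_fun do rewrite mulrDr mulrA (mulrC (gauss _) (- _)).
  exact: H.
Qed.

(** The numerical inequality behind the bound on [f']. With [a], [p], [Q] for the
    primitive, the density and [Phi], Birnbaum's inequality times [x ^ 2] reads
    [x ^ 2 * p * a <= (a - p) ^ 2]; this controls [- x * a], and
    [p <= 1 / 2] absorbs the remaining [a ^ 2]. *)
Lemma gauss_cdf_quadratic x : x <= 0 ->
  2 * (x * Phi x + gauss x) * (x * Phi x + gauss x - x) <= gauss x.
Proof.
move=> x0; have a0 := gauss_cdf_primitive_ge0 x0.
have B := gauss_cdf_birnbaum x0; have P0 := gauss_cdf_ge0 x.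
have p0 := gauss_gt0 x; have p1 := gauss_le_half x.
set p := gauss x in a0 B p0 p1 *; set Q := Phi x in a0 B P0 *.
set a := x * Q + p in a0 B *.
have xQ : x * Q = a - p by rewrite /a; ring.
have xQ0 : x * Q <= 0 by rewrite mulr_le0_ge0.
have ap : a <= p by lra.
have t0 : 0 <= a * (- x) by rewrite mulr_ge0// oppr_ge0.
have sq : (2 * (a * (- x)) * p) ^+ 2 <= ((p - a) * (p + a)) ^+ 2.
  have E1 : (2 * (a * (- x)) * p) ^+ 2 = 4 * p * (a * x ^+ 2) * (p * a) by ring.
  have E2 : 4 * p * (a * x ^+ 2) * Q ^+ 2 = 4 * p * a * (p - a) ^+ 2.
    by transitivity (4 * p * a * (x * Q) ^+ 2); [ring|rewrite xQ; ring].
  have le1 : (2 * (a * (- x)) * p) ^+ 2 <= 4 * p * a * (p - a) ^+ 2.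
    rewrite E1 -E2; apply: ler_wpM2l B; apply: mulr_ge0; first lra.
    by rewrite mulr_ge0// sqr_ge0.
  apply: (le_trans le1); rewrite exprMn [leRHS]mulrC ler_wpM2r ?sqr_ge0//.
  have := sqr_ge0 (p - a); nra.
have le2 : 2 * (a * (- x)) * p <= (p - a) * (p + a).
  have e1 : 0 <= 2 * (a * (- x)) * p by apply: mulr_ge0; lra.
  have e2 : 0 <= (p - a) * (p + a) by apply: mulr_ge0; lra.
  by rewrite -ler_sqr ?nnegrE.
rewrite -(ler_pM2r p0); have a2 := mulr_ge0 a0 a0.
have : 2 * a * (a - x) * p = 2 * (a * (- x)) * p + 2 * p * (a * a) by ring.
move=> ->.
have : 2 * p * (a * a) <= a * a by rewrite ler_piMl//; lra.
by nra.
Qed.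

End gaussian_tail.

(** * Stein's equation *)

Section stein_equation.
Variable R : realType.
Implicit Types (h f dh : R -> R) (c x y z : R).
Local Notation mu := (@lebesgue_measure R).

(** The decay of [f * gauss] singles out one solution and is stable under
    the symmetries used below, unlike an explicit integral formula. *)
Definition stein_solution h c f :=
  [/\ forall x, is_derive x 1 f (x * f x + (h x - c)),
      (fun n => f (- n%:R) * gauss (- n%:R)) @ \oo --> 0 &
      (fun n => f n%:R * gauss n%:R) @ \oo --> 0].

Lemma stein_solution_exists h : continuous h ->
  mu.-integrable setT (EFin \o (fun x => h x * gauss x)) ->
  exists f, stein_solution h (\int[mu]_x (h x * gauss x)) f.
Proof.
move=> ch ih; set c := \int[mu]_x _.
have ic : integ mu (fun x => c * gauss x) by apply: integZ; exact: integrable_gauss.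
have [||u [ug uN uP]] := @primitive_on_line R (fun x => (h x - c) * gauss x).
- move=> x; apply: cvgM; last exact: continuous_gauss.
  by apply: cvgB; [exact: ch|exact: cvg_cst].
- have := integB ih ic.
  by congr (mu.-integrable _ _); apply/funext => x /=; rewrite mulrBl.
have g0 x : gauss x != 0 :> R by rewrite gt_eqF ?gauss_gt0.
exists (fun x => u x / gauss x); split.
- move=> x; have d1 := is_derive_mul (ug x) (is_derive_inv (g0 x) (is_derive_gauss x)).
  by apply: (is_derive_eq d1); field; exact: g0.
- by under eq_fun do rewrite divfK//.
- under eq_fun do rewrite divfK//.
  suff -> : 0 = \int[mu]_x ((h x - c) * gauss x) by [].
  under eq_Rintegral do rewrite mulrBl.
  rewrite RintegralB// RintegralZl ?integrable_gauss//.
  by rewrite Rintegral_gauss mulr1 subrr.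
Qed.

(** This and the next two symmetries reduce the bounds to nondecreasing data and to
    the left half-line: adding the identity turns a derivative in [-1, 1] into
    one in [0, 2]. *)
Lemma stein_solution_addid h c f : stein_solution h c f ->
  stein_solution (fun x => h x + x) c (fun x => f x - 1).
Proof.
have g0 x : `|1 : R| <= 1 + x ^+ 2 by rewrite normr1 lerDl sqr_ge0.
move=> [fd fN fP]; split.
- move=> x; apply: (is_derive_eq (is_derive_sub (fd x) (is_derive_const 1 x))).
  by ring.
- under eq_fun do rewrite mulrBl.
  have H := cvgB fN (cvg_gauss_left g0); rewrite subr0 in H; exact: H.
- under eq_fun do rewrite mulrBl.
  have H := cvgB fP (cvg_gauss_right g0); rewrite subr0 in H; exact: H.
Qed.

Lemma stein_solution_opp h c f : stein_solution h c f ->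
  stein_solution (fun x => - h x) (- c) (fun x => - f x).
Proof.
move=> [fd fN fP]; split.
- by move=> x; apply: (is_derive_eq (is_deriveN (fd x))); ring.
- under eq_fun do rewrite mulNr.
  by have H := cvgN fN; rewrite oppr0 in H; exact: H.
- under eq_fun do rewrite mulNr.
  by have H := cvgN fP; rewrite oppr0 in H; exact: H.
Qed.

Lemma stein_solution_reflect h c f : stein_solution h c f ->
  stein_solution (fun x => - h (- x)) (- c) (fun x => f (- x)).
Proof.
move=> [fd fN fP]; split.
- move=> x; have dN : is_derive x 1 (-%R : R -> R) (-1) by exact: is_deriveNid.
  by apply: (is_derive_eq (is_derive1_comp (fd (- x)) dN)); ring.
- by under eq_fun do rewrite opprK gauss_sym.
- by under eq_fun do rewrite -gauss_sym.
Qed.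

(** [u = f * gauss] has derivative [(h - c) * gauss] and vanishes at both ends;
    every bound compares it with an explicit function vanishing at one end, the
    sign of [h - c] deciding which. *)
Section nondecreasing_data.
Variables (h dh : R -> R) (c : R) (f : R -> R).
Hypothesis hd : forall x, is_derive x 1 h (dh x).
Hypothesis dh02 : forall x, 0 <= dh x <= 2.
Hypothesis fS : stein_solution h c f.

Let u x := f x * gauss x.

Let ud x : is_derive x 1 u ((h x - c) * gauss x).
Proof.
have [fd _ _] := fS.
by apply: (is_derive_eq (is_derive_mul (fd x) (is_derive_gauss x))); ring.
Qed.

Let h_le x y : x <= y -> h x <= h y.
Proof.
move=> xy; have [z _ E] := mean_value x y hd; have /andP[d0 _] := dh02 z.
by rewrite -subr_ge0 E mulr_ge0// subr_ge0.
Qed.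

Let h_lip x y : x <= y -> h y - h x <= 2 * (y - x).
Proof. by move=> xy; apply: (ler_of_derive_le hd) => // z _; case/andP: (dh02 z). Qed.

Let uN : (fun n => u (- n%:R)) @ \oo --> 0. Proof. by case: fS. Qed.

Let uP : (fun n => u n%:R) @ \oo --> 0. Proof. by case: fS. Qed.

Lemma stein_nondecreasing_le0 x : f x <= 0.
Proof.
suff : u x <= 0 by rewrite /u pmulr_lle0// gauss_gt0.
have [hc|hc] := leP (h x) c.
- apply: (le0_of_cvg_left ud) uN => z zx.
  by rewrite mulr_le0_ge0 ?gauss_ge0// subr_le0 (le_trans (h_le zx)).
- apply: (le0_of_cvg_right ud) uP => z xz.
  by rewrite mulr_ge0 ?gauss_ge0// subr_ge0 (le_trans (ltW hc)) ?h_le.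
Qed.

(** [psi] is the Gaussian density times the second derivative of [f] minus [h'],
    divided by [1 + x ^ 2]; its derivative has the sign of [h - c] as soon as
    this agrees with the sign of [x]. *)
Let rest x := x * (h x - c) * gauss x / (1 + x ^+ 2).

Let psi x := u x + rest x.

Let q_gt0 x : 0 < 1 + x ^+ 2.
Proof. by rewrite ltr_wpDr ?sqr_ge0. Qed.

Let psid x : is_derive x 1 psi (gauss x * (2 * (h x - c) / (1 + x ^+ 2) ^+ 2
  + x * dh x / (1 + x ^+ 2))).
Proof.
have qn0 : 1 + x ^+ 2 != 0 by rewrite gt_eqF.
have -> : psi = fun y => u y + (y * (h y - c) * gauss y) * (1 + y * y)^-1.
  by apply/funext => y; rewrite /psi /rest expr2.
have qn0' : 1 + x * x != 0 by rewrite -expr2.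
have d1 := is_derive_mul (is_derive_mul (is_derive_idfun x)
  (is_derive_sub (hd x) (is_derive_const c x))) (is_derive_gauss x).
have d2 := @is_derive_inv R (fun y => 1 + y * y) x _ qn0' (is_derive_add (is_derive_const 1 x)
  (is_derive_mul (is_derive_idfun x) (is_derive_idfun x))).
apply: (is_derive_eq (is_derive_add (ud x) (is_derive_mul d1 d2))).
by field; rewrite -?expr2 ?qn0.
Qed.

Let rest_cvg (s : bool) : (fun n => rest ((-1) ^+ s * n%:R)) @ \oo --> 0.
Proof.
pose K := `|h 0 - c| + 2.
have K0 : 0 < K by rewrite /K ltr_wpDl.
have bnd x : `|x * (h x - c) / (1 + x ^+ 2) / K| <= 1 + x ^+ 2.
  have hx : `|h x - c| <= `|h 0 - c| + 2 * `|x|.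
    have [x0|x0] := leP 0 x.
      have := h_le x0; have := h_lip x0; rewrite (ger0_norm x0) subr0 => h1 h2.
      rewrite ler_norml; apply/andP; split; have := ler_norm (h 0 - c);
        have := ler_norm (- (h 0 - c)); rewrite normrN; lra.
    have := h_le (ltW x0); have := h_lip (ltW x0); rewrite (ltr0_norm x0) sub0r => h1 h2.
    rewrite ler_norml; apply/andP; split; have := ler_norm (h 0 - c);
      have := ler_norm (- (h 0 - c)); rewrite normrN; lra.
  rewrite !normrM !normfV (gtr0_norm K0) (gtr0_norm (q_gt0 x)).
  rewrite ler_pdivrMr// ler_pdivrMr//.
  have x2 : x ^+ 2 = `|x| ^+ 2 by rewrite real_normK// num_real.
  rewrite x2; apply: le_trans (ler_wpM2l (normr_ge0 x) hx) _.
  have a0 := normr_ge0 (h 0 - c); have b0 := normr_ge0 x.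
  rewrite /K; set a := `|h 0 - c| in a0 *; set b := `|x| in b0 *.
  have bt : b <= 1 + b ^+ 2 by nra.
  have t1 : 1 <= 1 + b ^+ 2 by rewrite lerDl sqr_ge0.
  have h1 : b * (a + 2 * b) <= (a + 2) * (1 + b ^+ 2).
    have := ler_wpM2l a0 bt; nra.
  have h2 : 0 <= (a + 2) * (1 + b ^+ 2) by rewrite mulr_ge0//; lra.
  by have := ler_wpM2r h2 t1; lra.
have H := @cvg_gauss_poly R (fun x => x * (h x - c) / (1 + x ^+ 2) / K) s bnd.
have {}H := cvgM (cvg_cst K) H; rewrite mulr0 in H.
have -> : rest = fun x => K * (x * (h x - c) / (1 + x ^+ 2) / K * gauss x).
  by apply/funext => x; rewrite /rest; field; rewrite !gt_eqF.
exact: H.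
Qed.

(** The left-hand side is [f'' - h']. When [x] and [h x - c] have opposite signs
    both summands are nonpositive; otherwise [psi] is monotone from [x] to the
    infinite end on the same side of the origin. *)
Lemma stein_nondecreasing_derive2 x : (1 + x ^+ 2) * f x + x * (h x - c) <= 0.
Proof.
suff [] : psi x <= 0 \/ x * (h x - c) <= 0.
- rewrite /psi /rest /u => psi0.
  have E : ((1 + x ^+ 2) * f x + x * (h x - c)) * gauss x / (1 + x ^+ 2) <= 0.
    by apply: le_trans psi0; rewrite le_eqVlt; apply/orP; left; apply/eqP;
      field; rewrite gt_eqF.
  by move: E; rewrite pmulr_lle0 ?invr_gt0// pmulr_lle0// gauss_gt0.
- move=> xh; have f0 := stein_nondecreasing_le0 x.
  by have := mulr_ge0_le0 (ltW (q_gt0 x)) f0; lra.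
have psiN : (fun n => psi (- n%:R)) @ \oo --> 0.
  have := rest_cvg true; under eq_fun do rewrite mulN1r.
  by move=> /(cvgD uN); rewrite addr0.
have psiP : (fun n => psi n%:R) @ \oo --> 0.
  have := rest_cvg false; under eq_fun do rewrite mul1r.
  by move=> /(cvgD uP); rewrite addr0.
have [x0|x0] := leP 0 x; have [hc|hc] := leP (h x) c.
- by right; rewrite mulr_ge0_le0// subr_le0.
- left; apply: (le0_of_cvg_right psid) psiP => z xz.
  have z0 := le_trans x0 xz; have /andP[d0 _] := dh02 z.
  have hz := le_trans (ltW hc) (h_le xz).
  have e1 : 0 <= 2 * (h z - c) / (1 + z ^+ 2) ^+ 2.
    by apply: divr_ge0; rewrite ?sqr_ge0// mulr_ge0// subr_ge0.
  have e2 : 0 <= z * dh z / (1 + z ^+ 2).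
    by apply: divr_ge0; [exact: mulr_ge0|exact/ltW/q_gt0].
  by rewrite mulr_ge0 ?gauss_ge0// addr_ge0.
- left; apply: (le0_of_cvg_left psid) psiN => z zx.
  have z0 := le_trans zx (ltW x0); have /andP[d0 _] := dh02 z.
  have hz := le_trans (h_le zx) hc.
  have e1 : 2 * (h z - c) / (1 + z ^+ 2) ^+ 2 <= 0.
    rewrite pmulr_lle0 ?invr_gt0 ?exprn_gt0 ?q_gt0//.
    by rewrite pmulr_rle0// subr_le0.
  have e2 : z * dh z / (1 + z ^+ 2) <= 0.
    by rewrite pmulr_lle0 ?invr_gt0 ?q_gt0// mulr_le0_ge0.
  by rewrite mulr_ge0_le0 ?gauss_ge0//; lra.
- by right; rewrite mulr_le0_ge0 ?subr_ge0// ltW.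
Qed.

(** [u] is bounded below by replacing [h] to the left of [x] by the line of slope 2
    through its value there, and above by replacing it to the right of [x] by
    that value. Eliminating [h x - c] between the two bounds leaves
    [gauss_cdf_quadratic]. *)
Lemma stein_nondecreasing_derive1_le1 x : x <= 0 -> x * f x + (h x - c) <= 1.
Proof.
move=> x0.
have [Phi [dPhi PhiN PhiP]] := primitive_on_line (@continuous_gauss R) (integrable_gauss R).
rewrite Rintegral_gauss in PhiP.
have gN : (fun n => gauss (- n%:R) : R) @ \oo --> 0.
  have b1 : forall z : R, `|1 : R| <= 1 + z ^+ 2 by move=> z; rewrite normr1 lerDl sqr_ge0.
  by have := cvg_gauss_left b1; under eq_fun do rewrite mul1r.
set H := h x - c.
have lower : (H - 2 * x) * Phi x - 2 * gauss x - u x <= 0.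
  apply: (le0_of_cvg_left (u := fun t => (H - 2 * x) * Phi t - 2 * gauss t - u t)
    (du := fun t => gauss t * (h x - h t - 2 * (x - t)))).
  - move=> t; have d1 := is_derive_mul (is_derive_const (H - 2 * x) t) (dPhi t).
    have d2 := is_derive_mul (is_derive_const 2 t) (is_derive_gauss t).
    by apply: (is_derive_eq (is_derive_sub (is_derive_sub d1 d2) (ud t))); rewrite /H; ring.
  - by move=> t tx; rewrite mulr_ge0_le0 ?gauss_ge0// subr_le0 h_lip.
  - have L := cvgB (cvgB (cvgM (cvg_cst (H - 2 * x)) PhiN) (cvgM (cvg_cst (2 : R)) gN)) uN.
    by rewrite !mulr0 !subr0 in L; exact: L.
have upper : u x + H * (1 - Phi x) <= 0.
  apply: (le0_of_cvg_right (u := fun t => u t + H * (1 - Phi t))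
    (du := fun t => gauss t * (h t - h x))).
  - move=> t; have d1 := is_derive_mul (is_derive_const H t)
      (is_derive_sub (is_derive_const 1 t) (dPhi t)).
    by apply: (is_derive_eq (is_derive_add (ud t) d1)); rewrite /H; ring.
  - by move=> t xt; rewrite mulr_ge0 ?gauss_ge0// subr_ge0 h_le.
  - have L := cvgD uP (cvgM (cvg_cst H) (cvgB (cvg_cst (1 : R)) PhiP)).
    by rewrite subrr mulr0 addr0 in L; exact: L.
have Q := gauss_cdf_quadratic dPhi PhiN x0.
have A0 := gauss_cdf_primitive_ge0 dPhi PhiN x0.
have g0 := gauss_gt0 x.
rewrite -(ler_pM2r g0) mul1r.
have -> : (x * f x + (h x - c)) * gauss x = x * u x + H * gauss x.
  by rewrite /u /H; ring.
move: lower upper Q A0; set p := gauss x; set F := Phi x; set v := u x => lo up Q A0.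
have HA : H <= 2 * (x * F + p) by lra.
have xu : x * v <= x * ((H - 2 * x) * F - 2 * p) by rewrite ler_wnM2l//; lra.
apply: le_trans Q; have := ler_wpM2r A0 HA; lra.
Qed.

End nondecreasing_data.

(** The symmetries turn the one-sided bounds for nondecreasing data into two-sided
    ones on the whole line; the second quantity is [f'' - h']. *)
Lemma stein_solution_bounds h (dh : R -> R) c f :
  (forall x, is_derive x 1 h (dh x)) -> (forall x, `|dh x| <= 1) ->
  stein_solution h c f ->
  (forall x, `|x * f x + (h x - c)| <= 1) /\
  (forall x, `|(1 + x ^+ 2) * f x + x * (h x - c)| <= 1).
Proof.
have key h' (dh' : R -> R) c' f' : (forall x, is_derive x 1 h' (dh' x)) ->
    (forall x, `|dh' x| <= 1) -> stein_solution h' c' f' ->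
    (forall x, x <= 0 -> x * f' x + (h' x - c') <= 1) /\
    (forall x, (1 + x ^+ 2) * f' x + x * (h' x - c') <= 1).
  move=> hd dh1 fS; have gS := stein_solution_addid fS.
  have gd x : is_derive x 1 (fun x => h' x + x) (dh' x + 1).
    exact: (is_derive_add (hd x) (is_derive_idfun x)).
  have g02 x : 0 <= dh' x + 1 <= 2.
    by have := dh1 x; rewrite ler_norml => /andP[? ?]; apply/andP; split; lra.
  split => x.
  - move=> /(stein_nondecreasing_derive1_le1 gd g02 gS); apply: le_trans.
    by rewrite le_eqVlt; apply/orP; left; apply/eqP; ring.
  - have := stein_nondecreasing_derive2 gd g02 gS x; lra.
move=> hd dh1 fS.
have opp h' (dh' : R -> R) c' f' : (forall x, is_derive x 1 h' (dh' x)) ->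
    (forall x, `|dh' x| <= 1) -> stein_solution h' c' f' ->
    (forall x, x <= 0 -> `|x * f' x + (h' x - c')| <= 1) /\
    (forall x, `|(1 + x ^+ 2) * f' x + x * (h' x - c')| <= 1).
  move=> hd' dh1' fS'.
  have hdN x : is_derive x 1 (fun x => - h' x) (- dh' x) by exact: is_deriveN.
  have dhN x : `|- dh' x| <= 1 by rewrite normrN.
  have [a1 a2] := key _ _ _ _ hdN dhN (stein_solution_opp fS').
  have [b1 b2] := key _ _ _ _ hd' dh1' fS'.
  split => x; rewrite ler_norml.
  - move=> x0; have := a1 x x0; have := b1 x x0 => ? ?.
    by apply/andP; split; lra.
  - have := a2 x; have := b2 x => ? ?; apply/andP; split; lra.
have [a1 a2] := opp _ _ _ _ hd dh1 fS.
split => // x; have [/a1//|x0] := leP x 0.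
have hdR y : is_derive y 1 (fun y => - h (- y)) (dh (- y)).
  have dN : is_derive y 1 (-%R : R -> R) (-1) by exact: is_deriveNid.
  by apply: (is_derive_eq (is_deriveN (is_derive1_comp (hd (- y)) dN))); ring.
have [b1 _] := opp _ _ _ _ hdR (fun y => dh1 (- y)) (stein_solution_reflect fS).
have x0N : - x <= 0 by rewrite oppr_le0 ltW.
have := b1 _ x0N; rewrite opprK -normrN.
by apply: le_trans; rewrite le_eqVlt; apply/orP; left; apply/eqP; congr `|_|; ring.
Qed.

(** Interpolation between the oscillation bound 2 and the Lipschitz constant 2 of
    [f'] gives all Hölder exponents with the same constant. *)
Lemma stein_smooth h (dh : R -> R) :
  (forall x, is_derive x 1 h (dh x)) -> (forall x, `|dh x| <= 1) ->
  mu.-integrable setT (EFin \o (fun x => h x * gauss x)) ->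
  exists f df : R -> R,
  [/\ forall x, is_derive x 1 f (df x),
     forall x, df x = x * f x + (h x - \int[mu]_x (h x * gauss x)),
     forall x, `|df x| <= 1 &
     forall x y (d : R), 0 < d -> d <= 1 -> `|df x - df y| <= 2 * `|x - y| `^ d].
Proof.
move=> hd dh1 ih.
have ch : continuous h by move=> x; exact: is_derive_continuous (hd x).
have [f fS] := stein_solution_exists ch ih.
set c := \int[mu]_x _ in fS *.
have [b1 b2] := stein_solution_bounds hd dh1 fS.
pose df x := x * f x + (h x - c); exists f, df.
have [fd _ _] := fS; split => // x y d d0 d1.
have ddf z : is_derive z 1 df ((1 + z ^+ 2) * f z + z * (h z - c) + dh z).
  have dz := is_derive_idfun z.
  have e1 := is_derive_sub (hd z) (is_derive_const c z).
  by apply: (is_derive_eq (is_derive_add (is_derive_mul dz (fd z)) e1)); ring.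
have lip : `|df x - df y| <= 2 * `|x - y|.
  have [z _ ->] := mean_value y x ddf; rewrite normrM ler_wpM2r//.
  by rewrite (le_trans (ler_normD _ _))//; have := b2 z; have := dh1 z; lra.
have osc : `|df x - df y| <= 2.
  by rewrite (le_trans (ler_normB _ _))//; have := b1 x; have := b1 y; rewrite /df; lra.
have [xy|xy] := leP `|x - y| 1.
  have [E|N] := eqVneq `|x - y| 0.
    by move: lip; rewrite E mulr0 => /le_trans; apply; rewrite mulr_ge0// powR_ge0.
  apply: le_trans lip _; rewrite ler_wpM2l//; apply: ger1_powR => //.
  by rewrite xy andbT lt_neqAle eq_sym N normr_ge0.
apply: le_trans osc _; rewrite -[leLHS]mulr1 ler_wpM2l//.
have := ge0_ler_powR (ltW d0) (_ : 1 \is Num.nneg) (_ : `|x - y| \is Num.nneg) (ltW xy).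
by rewrite powR1; apply; rewrite nnegrE.
Qed.

End stein_equation.

(** * Expectation under the normal law *)

Section gaussian_expectation.
Variable R : realType.
Local Notation mu := (@lebesgue_measure R).

(** The growth of [h] is absorbed by passing to variance 2. *)
Lemma integrable_lipschitz_gauss (h : R -> R) (a : R) : measurable_fun setT h ->
  (forall x, `|h x| <= a + `|x|) ->
  mu.-integrable setT (EFin \o (fun x => h x * gauss x)).
Proof.
move=> mh ha; have s20 : Num.sqrt 2 != 0 :> R by rewrite gt_eqF// sqrtr_gt0.
have mg : measurable_fun setT (@gauss R) by exact: measurable_normal_pdf.
pose K : R := normal_peak 1 / normal_peak (Num.sqrt 2).
have K0 : 0 < normal_peak (Num.sqrt 2) :> R by exact: normal_peak_gt0.
have KE t : K * (normal_peak (Num.sqrt 2) * t) = normal_peak 1 * t.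
  by rewrite /K; field; rewrite gt_eqF.
have iw := integD (integZ a (integrable_gauss R))
  (integZ K (@integrable_normal_pdf R 0 (Num.sqrt 2))).
apply: (integ_le _ iw); first exact: measurable_funM.
move=> x; rewrite normrM (ger0_norm (gauss_ge0 x)).
apply: (@le_trans _ _ ((a + `|x|) * gauss x)).
  by rewrite ler_wpM2r ?gauss_ge0.
rewrite mulrDl lerD2l gaussE /= normal_pdfE// /normal_fun subr0 sqr_sqrtr//.
rewrite KE mulrCA ler_wpM2l ?normal_peak_ge0//.
have -> : - x ^+ 2 / (2 *+ 2) = - (x ^+ 2 / 4).
  by rewrite -mulr_natr; field.
have -> : - x ^+ 2 / 2 = - (x ^+ 2 / 4) + - (x ^+ 2 / 4) by field.
rewrite expRD mulrA ler_piMl ?expR_ge0// expRN ler_pdivrMr ?expR_gt0// mul1r.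
apply: le_trans (expR_ge1Dx _); rewrite -(real_normK (num_real x)).
by have := sqr_ge0 (`|x| - 2); nra.
Qed.

Lemma integral_normal_prob (f : R -> R) : measurable_fun setT f ->
  mu.-integrable setT (EFin \o (fun x => f x * gauss x)) ->
  (\int[normal_prob 0 1]_x (f x)%:E = \int[mu]_x (f x * gauss x)%:E)%E.
Proof.
move=> mf ifg; have dom := @normal_prob_dominates R 0 1.
have mg : measurable_fun setT (@gauss R) by exact: measurable_normal_pdf.
have aeg : ae_eq mu setT (Radon_Nikodym_SigmaFinite.f (normal_prob 0 1) mu)
    (EFin \o @gauss R).
  apply: integral_ae_eq => //.
  - exact: Radon_Nikodym_SigmaFinite.f_integrable.
  - exact/measurable_EFinP.
  - by move=> A _ mA; rewrite -Radon_Nikodym_SigmaFinite.f_integral.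
have mRN : measurable_fun setT (Radon_Nikodym_SigmaFinite.f (normal_prob (0 : R) 1) mu).
  by apply: measurable_int; exact: Radon_Nikodym_SigmaFinite.f_integrable.
have mfE : measurable_fun setT (EFin \o f) by exact/measurable_EFinP.
have iN : (@normal_prob R 0 1).-integrable setT (EFin \o f).
  apply/integrableP; split => //.
  rewrite -(Radon_Nikodym_SigmaFinite.change_of_variables dom)//; last first.
    exact: measurableT_comp.
  move/integrableP : ifg => [_]; apply: le_lt_trans.
  rewrite le_eqVlt; apply/orP; left; apply/eqP; apply: ae_eq_integral => //.
  - by apply: emeasurable_funM => //; exact: measurableT_comp.
  - by apply/measurable_EFinP; apply: measurableT_comp => //; exact: measurable_funM.
  - apply: filterS aeg => x gx _; rewrite gx//=.
    by rewrite normrM (ger0_norm (gauss_ge0 x)) EFinM.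
rewrite -(Radon_Nikodym_change_of_variables dom)//.
have aeRN := @ae_eq_Radon_Nikodym_SigmaFinite _ _ _ _ _ dom _ measurableT.
apply: ae_eq_integral => //.
- exact: emeasurable_funM.
- by apply/measurable_EFinP; exact: measurable_funM.
- by apply: filterS2 aeg aeRN => x gx rx _; rewrite -rx// gx.
Qed.

Lemma expectation_normal dN (TN : measurableType dN) (PN : probability TN R)
    (N : {RV PN >-> R}) (h : R -> R) (a : R) :
  (forall A : set R, measurable A -> distribution PN N A = normal_prob 0 1 A) ->
  measurable_fun setT h -> (forall x, `|h x| <= a + `|x|) ->
  ('E_PN[h \o N] = (\int[mu]_x (h x * gauss x))%:E)%E.
Proof.
move=> NN mh ha; have ih := integrable_lipschitz_gauss mh ha.
rewrite EFin_Rintegral// -integral_normal_prob//.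
have mhE : measurable_fun setT (EFin \o h : measurableTypeR R -> \bar R).
  exact/measurable_EFinP.
have mN : measurable_fun setT (N : TN -> measurableTypeR R).
  by move=> mT B mB; have mN0 : measurable_fun setT N by []; exact: (mN0 mT B mB).
pose NM := MeasurableFun.Pack (MeasurableFun.Class
  (isMeasurableFun.Build _ _ _ (measurableTypeR R) _ mN)).
rewrite unlock.
have -> : (\int[normal_prob 0 1]_x (h x)%:E = \int[distribution PN NM]_x (h x)%:E)%E.
  by apply: eq_measure_integral => A mA _; exact: esym (NN A mA).
rewrite integralE [RHS]integralE; congr (_ - _)%E.
- rewrite ge0_integral_distribution//; last exact: (measurable_funepos mhE).
  by apply: eq_integral => x _; rewrite /= !funeposE.
- rewrite ge0_integral_distribution//; last exact: (measurable_funeneg mhE).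
  by apply: eq_integral => x _; rewrite /= !funenegE.
Qed.

End gaussian_expectation.

(** * Convexity and Hölder inequalities for moments *)

(** The average of two tangent inequalities at [|alpha * x + (1 - alpha) * y|]. *)
Lemma powR_convex_comb (R : realType) (s alpha x y : R) : 1 < s -> 0 <= alpha <= 1 ->
  `|alpha * x + (1 - alpha) * y| `^ s <= alpha * `|x| `^ s + (1 - alpha) * `|y| `^ s.
Proof.
move=> s1 /andP[a0 a1]; set z := `|alpha * x + _|.
have a1' : 0 <= 1 - alpha by lra.
have zle : z <= alpha * `|x| + (1 - alpha) * `|y|.
  by rewrite (le_trans (ler_normD _ _))// !normrM (ger0_norm a0) (ger0_norm a1').
have Yx := @young_tangent R z `|x| s s1 (normr_ge0 _) (normr_ge0 _).
have Yy := @young_tangent R z `|y| s s1 (normr_ge0 _) (normr_ge0 _).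
have Zs : z `^ s = z `^ (s - 1) * z.
  by rewrite mulrC mulr_powRB1 ?normr_ge0//; lra.
have le1 := ler_wpM2l (powR_ge0 z (s - 1)) zle.
have s0 : 0 < s by lra.
have sV : 0 < s^-1 by rewrite invr_gt0.
have le2 := ler_wpM2l a0 Yx; have le3 := ler_wpM2l a1' Yy.
rewrite -(ler_pM2l sV).
move: Yx Yy le1 le2 le3; rewrite -Zs => _ _.
set p := z `^ (s - 1); set Zp := z `^ s; set X := `|x| `^ s; set Y := `|y| `^ s.
move=> le1 le2 le3.
have E1 : p * (alpha * `|x| + (1 - alpha) * `|y|) =
  alpha * (p * `|x|) + (1 - alpha) * (p * `|y|) by ring.
have E2 : alpha * (X / s + (1 - s^-1) * Zp) + (1 - alpha) * (Y / s + (1 - s^-1) * Zp)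
  = s^-1 * (alpha * X + (1 - alpha) * Y) + Zp - s^-1 * Zp by ring.
lra.
Qed.

Section nonneg_integrals.
Context d (T : measurableType d) (R : realType) (mu : {measure set T -> \bar R}).
Implicit Types f g : T -> R.

Lemma ae_integral_norm f : measurable_fun setT f -> {ae mu, forall w, 0 <= f w} ->
  (\int[mu]_w (f w)%:E = \int[mu]_w `|f w|%:E)%E.
Proof.
move=> mf f0; apply: ae_eq_integral => //.
- exact/measurable_EFinP.
- by apply/measurable_EFinP; exact: measurableT_comp.
- by apply: filterS f0 => w fw _; rewrite ger0_norm.
Qed.

Lemma ae_le_integral_norm f g : measurable_fun setT f -> measurable_fun setT g ->
  {ae mu, forall w, `|f w| <= g w} -> (\int[mu]_w `|f w|%:E <= \int[mu]_w (g w)%:E)%E.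
Proof.
move=> mf mg fg; rewrite (ae_integral_norm mg); last first.
  by apply: filterS fg => w; exact: le_trans.
apply: ae_ge0_le_integral => //.
- by apply/measurable_EFinP; exact: measurableT_comp.
- by apply/measurable_EFinP; exact: measurableT_comp.
- by apply: filterS fg => w fgw _; rewrite lee_fin (le_trans fgw)// ler_norm.
Qed.

Lemma ae_ge0_integralZl f (k : R) : measurable_fun setT f ->
  {ae mu, forall w, 0 <= f w} -> 0 <= k ->
  (\int[mu]_w (k * f w)%:E = k%:E * \int[mu]_w (f w)%:E)%E.
Proof.
move=> mf f0 k0; rewrite (ae_integral_norm mf f0) -ge0_integralZl//; last first.
  by apply/measurable_EFinP; exact: measurableT_comp.
rewrite ae_integral_norm//; last 2 first.
- exact: measurable_funM.
- by apply: filterS f0 => w fw; exact: mulr_ge0.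
by apply: eq_integral => w _; rewrite normrM (ger0_norm k0) EFinM.
Qed.

(** Hölder's inequality for the product of the counting measure on the index and
    [mu], by Young's inequality after normalising both factors. *)
Lemma holder_sum n (a b : 'I_n -> T -> R) (r s : R) :
  (forall k, measurable_fun setT (a k)) -> (forall k, measurable_fun setT (b k)) ->
  (forall k w, 0 <= a k w) -> (forall k w, 0 <= b k w) ->
  0 < r -> 0 < s -> r^-1 + s^-1 = 1 ->
  (\sum_(k < n) \int[mu]_w (a k w * b k w)%:E <=
   (\sum_(k < n) \int[mu]_w (a k w `^ r)%:E) `^ r^-1 *
   (\sum_(k < n) \int[mu]_w (b k w `^ s)%:E) `^ s^-1)%E.
Proof.
move=> ma mb a0 b0 r0 s0 rs.
have mpow f (t : R) : measurable_fun setT f -> measurable_fun setT (fun w => f w `^ t).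
  by move=> mf; exact: (measurableT_comp (measurable_powR t)).
have I0 (f : 'I_n -> T -> R) t k : (0 <= \int[mu]_w (f k w `^ t)%:E)%E.
  by apply: integral_ge0 => w _; rewrite lee_fin powR_ge0.
have S0 (f : 'I_n -> T -> R) t : (0 <= \sum_(k < n) \int[mu]_w (f k w `^ t)%:E)%E.
  by apply: sume_ge0 => k _; exact: I0.
have zero (f g : 'I_n -> T -> R) t : (forall k, measurable_fun setT (f k)) ->
    (forall k, measurable_fun setT (g k)) ->
    (\sum_(k < n) \int[mu]_w (f k w `^ t)%:E = 0)%E ->
    (\sum_(k < n) \int[mu]_w (f k w * g k w)%:E = 0)%E.
  move=> mf mg f0; apply: big1 => k _.
  have Ik : (\int[mu]_w (f k w `^ t)%:E = 0)%E.
    move/eqP: f0; rewrite seq_psume_eq0; last by move=> i _; exact: I0.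
    by move=> /allP /(_ k (mem_index_enum _)) /eqP.
  have [H _] := @ae_eq_integral_abs _ _ _ mu setT measurableT
    (fun w => (f k w `^ t)%:E) ((measurable_EFinP _ _).2 (mpow _ t (mf k))).
  have {}H : ae_eq mu setT (fun w => (f k w `^ t)%:E) (cst 0%E).
    by apply: H; rewrite -[RHS]Ik; apply: eq_integral => w _; rewrite /= ger0_norm ?powR_ge0.
  rewrite (ae_eq_integral (cst 0%E)) ?integral0//.
    by apply/measurable_EFinP; exact: measurable_funM.
  by apply: filterS H => w /(_ I)/= [/powR_eq0_eq0 ->] _; rewrite mul0r.
(* The degenerate cases in which a factor of the right-hand side is 0 or infinite. *)
have A0 := S0 a r; have B0 := S0 b s; have zA := zero a b r ma mb.
have zB : (\sum_(k < n) \int[mu]_w (b k w `^ s)%:E = 0)%E ->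
    (\sum_(k < n) \int[mu]_w (a k w * b k w)%:E = 0)%E.
  move=> /(zero b a s mb ma) E0; rewrite -[RHS]E0; apply: eq_bigr => k _.
  by under eq_integral do rewrite mulrC.
move EA : (\sum_(k < n) \int[mu]_w (a k w `^ r)%:E)%E A0 zA => A A0 zA.
move EB : (\sum_(k < n) \int[mu]_w (b k w `^ s)%:E)%E B0 zB => B B0 zB.
have [AE|An] := eqVneq A 0%E.
  by rewrite zA// mule_ge0// poweR_ge0.
have [BE|Bn] := eqVneq B 0%E.
  by rewrite zB// mule_ge0// poweR_ge0.
have Agt : (0 < A)%E by rewrite lt_neqAle eq_sym An.
have Bgt : (0 < B)%E by rewrite lt_neqAle eq_sym Bn.
have rV0 : r^-1 != 0 by rewrite invr_neq0// gt_eqF.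
have sV0 : s^-1 != 0 by rewrite invr_neq0// gt_eqF.
have [Ay|Afin] := eqVneq A +oo%E.
  by rewrite Ay poweRyr// gt0_mulye ?leey// poweR_gt0.
have [By|Bfin] := eqVneq B +oo%E.
  by rewrite By poweRyr// gt0_muley ?leey// poweR_gt0.
have {}Afin : A \is a fin_num by rewrite ge0_fin_numE// ltey.
have {}Bfin : B \is a fin_num by rewrite ge0_fin_numE// ltey.
have [x Ax] : exists x, A = x%:E by exists (fine A); rewrite fineK.
have [y By] : exists y, B = y%:E by exists (fine B); rewrite fineK.
have x0 : 0 < x by rewrite -lte_fin -Ax.
have y0 : 0 < y by rewrite -lte_fin -By.
rewrite Ax By !poweR_EFin -EFinM.
have := powR_gt0 r^-1 x0; have := powR_gt0 s^-1 y0.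
have : (x `^ r^-1) `^ r = x by rewrite -powRrM mulVf ?gt_eqF// powRr1// ltW.
have : (y `^ s^-1) `^ s = y by rewrite -powRrM mulVf ?gt_eqF// powRr1// ltW.
move: (x `^ r^-1) (y `^ s^-1) => u v vs ur v0 u0.
have young k w : a k w * b k w <=
    (u * v / (x * r)) * a k w `^ r + (u * v / (y * s)) * b k w `^ s.
  have := @conjugate_powR _ (a k w / u) (b k w / v) r s
    (divr_ge0 (a0 _ _) (ltW u0)) (divr_ge0 (b0 _ _) (ltW v0)) r0 s0 rs.
  have powV z t q : 0 <= z -> 0 < q -> (z / q) `^ t = z `^ t / q `^ t.
    move=> z0 q0; rewrite powRM// ?invr_ge0 ?(ltW q0)//; congr (_ * _).
    by rewrite -(powR_inv1 (ltW q0)) -powRrM mulN1r powRN.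
  rewrite !powV// ur vs => /(ler_wpM2l (ltW (mulr_gt0 u0 v0))).
  have -> : u * v * (a k w / u * (b k w / v)) = a k w * b k w.
    by field; rewrite !gt_eqF.
  move=> /le_trans; apply; rewrite le_eqVlt; apply/orP; left; apply/eqP.
  by field; rewrite !gt_eqF.
have mE f : measurable_fun setT f -> measurable_fun setT (fun w => (f w)%:E).
  by move=> mf; exact/measurable_EFinP.
pose ca := u * v / (x * r); pose cb := u * v / (y * s).
have ca0 : 0 <= ca by rewrite divr_ge0// mulr_ge0// ltW.
have cb0 : 0 <= cb by rewrite divr_ge0// mulr_ge0// ltW.
apply: (@le_trans _ _ (\sum_(k < n) (ca%:E * \int[mu]_w (a k w `^ r)%:E +
   cb%:E * \int[mu]_w (b k w `^ s)%:E))%E).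
  apply: lee_sum => k _.
  rewrite -ge0_integralZl//; last 2 first.
    by apply: mE; exact: mpow.
    by move=> w _; rewrite lee_fin powR_ge0.
  rewrite -ge0_integralZl//; last 2 first.
    by apply: mE; exact: mpow.
    by move=> w _; rewrite lee_fin powR_ge0.
  rewrite -ge0_integralD//; last 4 first.
  - by move=> w _; rewrite -EFinM lee_fin mulr_ge0// powR_ge0.
  - by under eq_fun do rewrite -EFinM; apply: mE; apply: measurable_funM => //; exact: mpow.
  - by move=> w _; rewrite -EFinM lee_fin mulr_ge0// powR_ge0.
  - by under eq_fun do rewrite -EFinM; apply: mE; apply: measurable_funM => //; exact: mpow.
  apply: ge0_le_integral => //.
  - by move=> w _; rewrite lee_fin mulr_ge0.
  - by apply: mE; exact: measurable_funM.
  - under eq_fun do rewrite -!EFinM -EFinD.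
    by apply: mE; apply: measurable_funD; apply: measurable_funM => //; exact: mpow.
  - by move=> w _; rewrite -!EFinM -EFinD lee_fin; exact: young.
rewrite big_split/= -ge0_sume_distrr; last by move=> k _; exact: I0.
rewrite -ge0_sume_distrr; last by move=> k _; exact: I0.
rewrite EA EB Ax By -!EFinM -EFinD lee_fin le_eqVlt; apply/orP; left; apply/eqP.
rewrite -[RHS]mulr1 -rs /ca /cb; field.
by rewrite !gt_eqF.
Qed.

End nonneg_integrals.

(** * Conditional Taylor expansion *)

Section conditional_taylor.
Context d (T : measurableType d) (R : realType) (P : probability T R).
Variable G : set (set T).
Hypotheses (sG : sigma_algebra setT G) (mG : G `<=` measurable).
Local Notation integ := (integ P).
Implicit Types (U V M H D Q W : T -> R).

Lemma is_condexpZ c U V : integ U -> is_condexp P G U V ->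
  is_condexp P G (fun w => c * U w) (fun w => c * V w).
Proof.
move=> iU UV; apply: (is_condexp_mul sG mG (H := fun=> c)) => //.
  exact: measurable_wrt_cst.
exact: integZ.
Qed.

(** The first-order term [H * D] has conditional expectation zero, so conditioning
    a first-order expansion around [M] leaves only the remainder. *)
Lemma condexp_first_order U V M H D Q W c :
  integ U -> is_condexp P G U V -> integ M -> measurable_wrt G M ->
  measurable_wrt G H -> integ D -> is_condexp P G D (fun=> 0) ->
  integ (fun w => H w * D w) -> integ Q -> is_condexp P G Q W ->
  (forall w, `|U w - M w - H w * D w| <= c * Q w) ->
  {ae P, forall w, `|V w - M w| <= c * W w}.
Proof.
move=> iU UV iM GM GH iD D0 iHD iQ QW bnd.
have HD0 := is_condexp_mul sG mG iD D0 GH iHD.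
have UMV := is_condexpB sG mG iU iM UV (is_condexp_id mG GM iM).
have iUM := integB iU iM.
have RV := is_condexpB sG mG iUM iHD UMV HD0.
have iR := integB iUM iHD.
have QcW := is_condexpZ c iQ QW; have QncW := is_condexpZ (- c) iQ QW.
have up : {ae P, forall w, V w - M w - H w * 0 <= c * W w}.
  apply: (is_condexp_le sG mG iR (integZ c iQ) RV QcW).
  by apply: aeW => w; rewrite (le_trans (ler_norm _)).
have lo : {ae P, forall w, - c * W w <= V w - M w - H w * 0}.
  apply: (is_condexp_le sG mG (integZ (- c) iQ) iR QncW RV).
  by apply: aeW => w; have := bnd w; rewrite ler_norml mulNr => /andP[].
by apply: filterS2 up lo => w; rewrite mulr0 subr0 mulNr ler_norml => -> ->.
Qed.

End conditional_taylor.

Lemma powR_le_1Dsqr (R : realType) (x a : R) : 0 <= a -> a <= 2 ->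
  `|x| `^ a <= 1 + x ^+ 2.
Proof.
move=> a0 a2; have [x1|x1] := leP `|x| 1.
  have : `|x| `^ a <= 1.
    have := ge0_ler_powR a0 (_ : `|x| \is Num.nneg) (_ : 1 \is Num.nneg) x1.
    by rewrite powR1; apply; rewrite nnegrE.
  by move=> /le_trans; apply; rewrite lerDl sqr_ge0.
apply: (@le_trans _ _ (`|x| `^ 2)); first by apply: ler_powR => //; exact: ltW.
rewrite -[2]/(2%:R) powR_mulrn// real_normK ?num_real//.
by rewrite lerDr.
Qed.

Section moments.
Context d (T : measurableType d) (R : realType) (P : probability T R).
Local Notation integ := (integ P).
Implicit Types U : T -> R.

Lemma measurable_normr_powR U a : measurable_fun setT U ->
  measurable_fun setT (fun w => `|U w| `^ a).
Proof.
move=> mU; apply: (measurableT_comp (measurable_powR a)).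
exact: measurableT_comp.
Qed.

Lemma integ_powR U a : square_integrable P U -> 0 <= a -> a <= 2 ->
  integ (fun w => `|U w| `^ a).
Proof.
move=> [mU iU] a0 a2; apply: (integ_le _ (integD (integ_cst P 1) iU)).
  exact: measurable_normr_powR.
by move=> w; rewrite ger0_norm ?powR_ge0// powR_le_1Dsqr.
Qed.

Lemma square_integrable_lipschitz U (g : R -> R) (B : R) : measurable_fun setT g ->
  (forall x, `|g x| <= `|g 0| + B * `|x|) ->
  square_integrable P U -> square_integrable P (fun w => g (U w)).
Proof.
move=> mg gB U2; have [mU iU] := U2.
have mgU : measurable_fun setT (fun w => g (U w)) by exact: measurableT_comp mg mU.
split => //.
have iw := integD (integ_cst P (2 * g 0 ^+ 2)) (integZ (2 * B ^+ 2) iU).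
apply: (integ_le _ iw); first exact: measurable_funX.
move=> w; rewrite ger0_norm ?sqr_ge0//.
have := gB (U w); rewrite -(real_normK (num_real (g (U w)))).
rewrite -(real_normK (num_real (g 0))) -(real_normK (num_real (U w))).
move: (normr_ge0 (g (U w))) (normr_ge0 (g 0)) (normr_ge0 (U w)).
set p := `|g (U w)|; set q := `|g 0|; set u := `|U w| => p0 q0 u0 le1.
have s : p ^+ 2 <= (q + B * u) ^+ 2 by rewrite lerXn2r ?nnegrE// (le_trans p0).
apply: (le_trans s); have := sqr_ge0 (q - B * u); nra.
Qed.

End moments.

(** * The covariance bound *)

Section stein_covariance.
Context d d' (T : measurableType d) (E : measurableType d') (R : realType).
Variables (P : probability T R) (n : nat) (X : 'I_n -> {RV P >-> E}).
Hypothesis X_indep : mutually_independent X.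
Local Notation integ := (integ P).
Local Notation sq := (square_integrable P).
Local Notation sX := (sigma_coords X).
Implicit Types (U V : T -> R) (k : 'I_n).

Let sG S := sigma_coords_sigma_algebra X S.
Let mG S := @sigma_coords_measurable _ _ _ _ _ _ _ X S.

Lemma condexp_coords_sq S U : sq U -> sq (condexp P (sX S) U).
Proof.
move=> U2; have iU := square_integrable_integ U2.
exact: square_integrable_condexp (sG S) (@mG S) (condexp_coordsP X S iU) U2.
Qed.

Lemma Dcoord_sq k U : sq U -> sq (Dcoord X k U).
Proof. by move=> U2; apply: square_integrableB => //; exact: condexp_coords_sq. Qed.

Lemma Dcoord_mix_sq a k U : sq U -> sq (Dcoord_mix X a k U).
Proof.
move=> U2; have D2 := Dcoord_sq k U2.
by apply: square_integrableD; apply: square_integrableZ; exact: condexp_coords_sq.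
Qed.

Lemma Dcoord_mix_integ a k U : integ U -> integ (Dcoord_mix X a k U).
Proof.
move=> iU; have iD := Dcoord_integ X k iU.
by apply: integD; apply: integZ; exact: condexp_coords_integ.
Qed.

Let wrtT S U : integ U -> measurable_wrt (sX setT) (condexp P (sX S) U).
Proof.
move=> iU; have [GV _ _] := condexp_coordsP X S iU.
by apply: measurable_wrtS GV; exact: sigma_coords_sub.
Qed.

Lemma Dcoord_wrt k U : integ U -> measurable_wrt (sX setT) U ->
  measurable_wrt (sX setT) (Dcoord X k U).
Proof. by move=> iU GU; apply: (measurable_wrtB (sG _)) => //; exact: wrtT. Qed.

Lemma Dcoord_mix_wrt a k U : integ U -> measurable_wrt (sX setT) U ->
  measurable_wrt (sX setT) (Dcoord_mix X a k U).
Proof.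
move=> iU GU; have iD := Dcoord_integ X k iU.
apply: (measurable_wrtD (sG _)); apply: (measurable_wrtM (sG _));
  try exact: (measurable_wrt_cst (sG _)); exact: wrtT.
Qed.

Lemma Zmix_wrt a U : integ U -> measurable_wrt (sX setT) U ->
  measurable_wrt (sX setT) (Zmix X a U).
Proof.
move=> iU GU; apply: (measurable_wrt_sum (sG _)) => k.
apply: (measurable_wrtM (sG _)); first exact: Dcoord_wrt.
exact: Dcoord_mix_wrt.
Qed.

Lemma Zmix_integ a U : sq U -> integ (Zmix X a U).
Proof.
move=> U2; apply: integ_sum => k; apply: square_integrableM.
  exact: Dcoord_sq.
exact: Dcoord_mix_sq.
Qed.

Variables (F : T -> R) (F2 : sq F).
Variables (g dg : R -> R) (K B delta : R).
Hypothesis gd : forall x : R, is_derive x 1 g (dg x).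
Hypothesis mdg : measurable_fun setT dg.
Hypothesis dgB : forall x, `|dg x| <= B.
Hypothesis delta01 : 0 < delta <= 1.
Hypothesis dgK : forall x y, `|dg x - dg y| <= K * `|x - y| `^ delta.

Let D k := Dcoord X k F.
Let iF : integ F. Proof. exact: square_integrable_integ. Qed.
Let mF : measurable_fun setT F. Proof. exact: integ_measurable iF. Qed.

Let dl0 : 0 < delta. Proof. by case/andP: delta01. Qed.
Let dl1 : delta <= 1. Proof. by case/andP: delta01. Qed.

Let K0 : 0 <= K.
Proof.
by have := dgK 1 0; rewrite subr0 normr1 powR1 mulr1; apply: le_trans.
Qed.

Let B0 : 0 <= B. Proof. exact: le_trans (dgB 0). Qed.

Let mg : measurable_fun setT g.
Proof.
by apply: continuous_measurable_fun => x; exact: is_derive_continuous (gd x).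
Qed.

Let g_lip x : `|g x| <= `|g 0| + B * `|x|.
Proof.
have [z _ E0] := mean_value 0 x gd.
have -> : g x = g 0 + dg z * x by rewrite -[x in dg z * x]subr0 -E0; ring.
by rewrite (le_trans (ler_normD _ _))// lerD2l normrM ler_wpM2r.
Qed.

Let gF2 : sq (fun w => g (F w)).
Proof. exact: square_integrable_lipschitz mg g_lip F2. Qed.

Let taylor x y : `|g x - g y - dg y * (x - y)| <= K * `|x - y| `^ (1 + delta).
Proof.
have [z zxy E0] := mean_value y x gd.
rewrite E0 -mulrBl normrM.
have zy : `|z - y| <= `|x - y|.
  have := ler_norm (x - y); have := ler_norm (- (x - y)); rewrite normrN => n1 n2.
  move: zxy; rewrite ler_norml; have [yx|xy] := leP y x => /andP[zl zr];
    by apply/andP; split; lra.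
have -> : `|x - y| `^ (1 + delta) = `|x - y| `^ delta * `|x - y|.
  have d0 : 0 < 1 + delta by have := dl0; lra.
  by rewrite -(mulr_powRB1 (normr_ge0 _) d0) mulrC; congr (_ `^ _ * _); ring.
rewrite mulrA ler_wpM2r// (le_trans (dgK _ _))// ler_wpM2l//.
by apply: ge0_ler_powR; rewrite ?nnegrE// ltW.
Qed.

Section one_coordinate.
Variable k : 'I_n.
Let G := sX [set j | j != k].
Let Y := condexp P G F.

Let FY : is_condexp P G F Y. Proof. exact: condexp_coordsP. Qed.
Let GY : measurable_wrt G Y. Proof. by case: FY. Qed.
Let iY : integ Y. Proof. by case: FY. Qed.
Let DE w : D k w = F w - Y w. Proof. by []. Qed.
Let D2 : sq (D k). Proof. exact: Dcoord_sq. Qed.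
Let iD : integ (D k). Proof. exact: square_integrable_integ. Qed.

Let D0 : is_condexp P G (D k) (fun=> 0).
Proof.
have := is_condexpB (sG _) (@mG _) iF iY FY (is_condexp_id (@mG _) GY iY).
by congr is_condexp; apply/funext => w; rewrite subrr.
Qed.

Let iQ a : 0 <= a -> a <= 2 -> integ (fun w => `|D k w| `^ a).
Proof. exact: integ_powR. Qed.

(** Both [dg (F w)] and its conditional expectation are compared with [dg] at the
    [k]-th conditional expectation of [F]. *)
Lemma Dcoord_derivative_le : {ae P, forall w,
  `|Dcoord X k (fun w => dg (F w)) w| <=
  K * (`|D k w| `^ delta + Ecoord X k (fun w => `|D k w| `^ delta) w)}.
Proof.
have mdgF : measurable_fun setT (fun w => dg (F w)) by exact: measurableT_comp mdg mF.
have idg U : measurable_fun setT U -> integ (fun w => dg (U w)).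
  move=> mU; apply: (integ_le _ (integ_cst P B)) => //.
  exact: measurableT_comp mdg mU.
have i1 := idg _ mF; have i2 := idg _ (integ_measurable iY).
have GdY : measurable_wrt G (fun w => dg (Y w)) by exact: (measurable_wrt_comp (sG _)).
have iQd : integ (fun w => `|D k w| `^ delta) by apply: iQ; have := dl0; have := dl1; lra.
have H := condexp_first_order (sG _) (@mG _) i1 (condexp_coordsP X _ i1) i2 GdY
  (measurable_wrt_cst (sG _) (c := 0)) iD D0 _ iQd (condexp_coordsP X _ iQd).
have {}H : {ae P, forall w, `|condexp P G (fun w => dg (F w)) w - dg (Y w)| <=
    K * condexp P G (fun w => `|D k w| `^ delta) w}.
  apply: H; first by under eq_fun do rewrite mul0r; exact: integ_cst.
  by move=> w; rewrite mul0r subr0; exact: dgK.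
apply: filterS H => w Hw; rewrite /Dcoord /Ecoord -/G mulrDr.
have -> : dg (F w) - condexp P G (fun w => dg (F w)) w =
    (dg (F w) - dg (Y w)) - (condexp P G (fun w => dg (F w)) w - dg (Y w)) by ring.
by rewrite (le_trans (ler_normB _ _))// lerD//; exact: dgK.
Qed.

(** The same base point is used for both Taylor expansions: the first-order term of
    the one inside the conditional expectation averages out. *)
Lemma Dcoord_taylor : {ae P, forall w,
  `|Dcoord X k (fun w => g (F w)) w - dg (F w) * D k w| <=
  K * (`|D k w| `^ (1 + delta) + Ecoord X k (fun w => `|D k w| `^ (1 + delta)) w)}.
Proof.
have igF := square_integrable_integ gF2.
have gY2 := square_integrable_lipschitz mg g_lip (condexp_coords_sq [set j | j != k] F2).
have igY := square_integrable_integ gY2.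
have GgY : measurable_wrt G (fun w => g (Y w)) by exact: (measurable_wrt_comp (sG _)).
have GdY : measurable_wrt G (fun w => dg (Y w)) by exact: (measurable_wrt_comp (sG _)).
have iQd : integ (fun w => `|D k w| `^ (1 + delta)) by apply: iQ; have := dl0; have := dl1; lra.
have idD : integ (fun w => dg (Y w) * D k w).
  apply: (@integM_bounded _ _ _ _ _ _ B) => //.
  exact: measurableT_comp mdg (integ_measurable iY).
have H := condexp_first_order (sG _) (@mG _) igF (condexp_coordsP X _ igF) igY GgY
  GdY iD D0 idD iQd (condexp_coordsP X _ iQd).
have {}H : {ae P, forall w, `|condexp P G (fun w => g (F w)) w - g (Y w)| <=
    K * condexp P G (fun w => `|D k w| `^ (1 + delta)) w}.
  by apply: H => w; exact: taylor.
apply: filterS H => w Hw.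
change (`|(g (F w) - condexp P G (fun w => g (F w)) w) - dg (F w) * D k w| <=
  K * (`|D k w| `^ (1 + delta) + condexp P G (fun w => `|D k w| `^ (1 + delta)) w)).
rewrite [K * _]mulrDr.
have -> : g (F w) - condexp P G (fun w => g (F w)) w - dg (F w) * D k w =
    - (g (Y w) - g (F w) - dg (F w) * (Y w - F w)) -
    (condexp P G (fun w => g (F w)) w - g (Y w)) by rewrite DE; ring.
rewrite (le_trans (ler_normB _ _))// lerD// normrN DE.
by have := taylor (Y w) (F w); rewrite (distrC (Y w)).
Qed.

End one_coordinate.

Definition Dsum (a : R) k (w : T) : R :=
  `|D k w| `^ a + Ecoord X k (fun w => `|D k w| `^ a) w.

Lemma Ecoord_powR_ge0 a k : 0 <= a -> a <= 2 ->
  {ae P, forall w, 0 <= Ecoord X k (fun w => `|D k w| `^ a) w}.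
Proof.
move=> a0 a2; have iQ := integ_powR (Dcoord_sq k F2) a0 a2.
have i0 := integ_cst P 0.
have G0 : measurable_wrt (sX [set j | j != k]) (fun=> 0 : R).
  exact: (measurable_wrt_cst (sG _)).
exact: (is_condexp_le (sG _) (@mG _) i0 iQ (is_condexp_id (@mG _) G0 i0)
  (condexp_coordsP X [set j | j != k] iQ) (aeW _ (fun w => powR_ge0 _ _))).
Qed.

Lemma Dsum_ge0 a k : 0 <= a -> a <= 2 -> {ae P, forall w, 0 <= Dsum a k w}.
Proof.
move=> a0 a2; apply: filterS (Ecoord_powR_ge0 k a0 a2) => w Hw.
by rewrite addr_ge0// powR_ge0.
Qed.

Lemma measurable_Dsum a k : 0 <= a -> a <= 2 -> measurable_fun setT (Dsum a k).
Proof.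
move=> a0 a2; have iQ := integ_powR (Dcoord_sq k F2) a0 a2.
apply: measurable_funD; first exact: integ_measurable iQ.
exact: integ_measurable (condexp_coords_integ X _ iQ).
Qed.

Let term_le a k (r Y : T -> R) : 0 <= a -> a <= 2 -> integ Y ->
  integ (fun w => r w * Y w) -> measurable_fun setT r ->
  {ae P, forall w, `|r w| <= K * Dsum a k w} ->
  ((`|\int[P]_w (r w * Y w)|)%:E <= K%:E * \int[P]_w (Dsum a k w * `|Y w|)%:E)%E.
Proof.
move=> a0 a2 iY irY mr rq; have mY := integ_measurable iY.
have mq := measurable_Dsum k a0 a2; have q0 := Dsum_ge0 k a0 a2.
have mnY : measurable_fun setT (fun w => `|Y w|) by exact: measurableT_comp.
apply: (@le_trans _ _ (\int[P]_w `|r w * Y w|%:E)%E).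
  rewrite -EFin_Rintegral; last exact: integ_norm.
  by rewrite lee_fin; exact: le_normr_Rintegral.
rewrite -ae_ge0_integralZl//; last 2 first.
- exact: measurable_funM.
- by apply: filterS q0 => w qw; exact: mulr_ge0.
apply: ae_le_integral_norm.
- exact: measurable_funM.
- by apply: measurable_funM => //; exact: measurable_funM.
- by apply: filterS rq => w rw; rewrite normrM mulrA ler_wpM2r.
Qed.

Lemma Dsum_integral_ge0 a k (Y : T -> R) : 0 <= a -> a <= 2 -> measurable_fun setT Y ->
  (0 <= \int[P]_w (Dsum a k w * `|Y w|)%:E)%E.
Proof.
move=> a0 a2 mY; rewrite ae_integral_norm.
- by apply: integral_ge0.
- apply: measurable_funM; first exact: measurable_Dsum.
  exact: measurableT_comp.
- by apply: filterS (Dsum_ge0 k a0 a2) => w qw; exact: mulr_ge0.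
Qed.

Let EFin_sum_le (r : 'I_n -> R) (s : 'I_n -> \bar R) :
  (forall k, (`|r k|%:E <= K%:E * s k)%E) -> (forall k, (0 <= s k)%E) ->
  ((`|\sum_(k < n) r k|)%:E <= K%:E * \sum_(k < n) s k)%E.
Proof.
move=> rs s0; rewrite ge0_sume_distrr//.
apply: (@le_trans _ _ (\sum_(k < n) `|r k|)%:E).
  by rewrite lee_fin ler_norm_sum.
by rewrite -sumEFin; apply: lee_sum.
Qed.

(** Three applications of the covariance identity: to [g(F)] against [F], to [F]
    against itself, which says that [Z] has mean [E F^2], and to [dg(F)] against
    [Z]. In the last one [Z] is merely integrable, but [dg(F)] is bounded. *)
Lemma stein_covariance_bound alpha beta :
  measurable_wrt (sX setT) F -> \int[P]_w F w = 0 ->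
  (`|(\int[P]_w (F w ^+ 2)) * \int[P]_w dg (F w) - \int[P]_w (F w * g (F w))|%:E <=
   K%:E * (\sum_(k < n)
      \int[P]_w (Dsum delta k w * `|Dcoord_mix X beta k (Zmix X alpha F) w|)%:E
   + \sum_(k < n)
      \int[P]_w (Dsum (1 + delta) k w * `|Dcoord_mix X alpha k F w|)%:E))%E.
Proof.
move=> GF F0; set Z := Zmix X alpha F.
have h0 : 0 <= delta by exact: ltW.
have h2 : delta <= 2 by have := dl1; lra.
have h1 : 0 <= 1 + delta by have := dl0; lra.
have h12 : 1 + delta <= 2 by have := dl1; lra.
have iZ : integ Z by exact: Zmix_integ.
have GZ : measurable_wrt (sX setT) Z by exact: Zmix_wrt.
have bdg : ae_bounded P (fun w => dg (F w)).
  split; first exact: measurableT_comp mdg mF.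
  by exists B; exact: aeW.
have c1 := covariance_Dcoord X_indep (dual_square_integrable P) alpha gF2 F2 GF.
have c2 := covariance_Dcoord X_indep (dual_square_integrable P) alpha F2 F2 GF.
have c3 := covariance_Dcoord X_indep (dual_bounded_integ P) beta bdg iZ GZ.
rewrite F0 !mulr0 !subr0 in c1 c2.
have iDD k : integ (fun w => D k w * Dcoord_mix X alpha k F w).
  by apply: square_integrableM; [exact: Dcoord_sq|exact: Dcoord_mix_sq].
have EZ : \int[P]_w Z w = \int[P]_w (F w ^+ 2).
  rewrite Rintegral_sum; last exact: iDD.
  by rewrite c2; apply: eq_Rintegral => w _; rewrite expr2.
have idD k : integ (fun w => dg (F w) * (D k w * Dcoord_mix X alpha k F w)).
  by apply: (@integM_bounded _ _ _ _ _ _ B) => //; exact: measurableT_comp mdg mF.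
have EdgZ : \int[P]_w (dg (F w) * Z w) =
    \sum_(k < n) \int[P]_w (dg (F w) * (D k w * Dcoord_mix X alpha k F w)).
  by rewrite -Rintegral_sum//; apply: eq_Rintegral => w _; rewrite /Z /Zmix mulr_sumr.
have igD k : integ (fun w => Dcoord X k (fun w => g (F w)) w * Dcoord_mix X alpha k F w).
  by apply: square_integrableM; [exact: Dcoord_sq|exact: Dcoord_mix_sq].
pose r k w := Dcoord X k (fun w => g (F w)) w - dg (F w) * D k w.
have rE k : \int[P]_w (r k w * Dcoord_mix X alpha k F w) =
    \int[P]_w (Dcoord X k (fun w => g (F w)) w * Dcoord_mix X alpha k F w) -
    \int[P]_w (dg (F w) * (D k w * Dcoord_mix X alpha k F w)).
  rewrite -RintegralB//; [|exact: igD|exact: idD].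
  by apply: eq_Rintegral => w _; rewrite /r; ring.
have key : (\int[P]_w (F w ^+ 2)) * \int[P]_w dg (F w) - \int[P]_w (F w * g (F w)) =
    - (\sum_(k < n) \int[P]_w (Dcoord X k (fun w => dg (F w)) w * Dcoord_mix X beta k Z w)
     + \sum_(k < n) \int[P]_w (r k w * Dcoord_mix X alpha k F w)).
  have alg (s2 m mFg mgF S1 S2 mZ : R) : S1 = mZ - m * s2 -> S2 = mgF - mZ ->
    mFg = mgF -> s2 * m - mFg = - (S1 + S2) by move=> -> -> ->; ring.
  apply: (alg _ _ _ (\int[P]_w (g (F w) * F w)) _ _ (\int[P]_w (dg (F w) * Z w))).
  - by rewrite -EZ; exact: c3.
  - apply: (etrans (eq_bigr _ (fun k _ => rE k))); apply: (etrans (sumrB _ _ _ _)).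
    by congr (_ - _); [exact: c1|exact: esym EdgZ].
  - by apply: eq_Rintegral => w _; rewrite mulrC.
have idg : integ (fun w => dg (F w)) by exact: ae_bounded_integ bdg.
rewrite key normrN; apply: (@le_trans _ _ (`|\sum_(k < n) \int[P]_w
    (Dcoord X k (fun w => dg (F w)) w * Dcoord_mix X beta k Z w)|%:E +
   `|\sum_(k < n) \int[P]_w (r k w * Dcoord_mix X alpha k F w)|%:E)%E).
  by rewrite -EFinD lee_fin ler_normD.
have mixZ k := integ_measurable (Dcoord_mix_integ beta k iZ).
have mixF k := integ_measurable (Dcoord_mix_integ alpha k iF).
rewrite ge0_muleDr; last 2 first.
- by apply: sume_ge0 => k _; exact: (Dsum_integral_ge0 k h0 h2 (mixZ k)).
- by apply: sume_ge0 => k _; exact: (Dsum_integral_ge0 k h1 h12 (mixF k)).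
apply: leeD; apply: EFin_sum_le => k.
- apply: (term_le h0 h2 (Dcoord_mix_integ beta k iZ)); last exact: Dcoord_derivative_le.
  + have BD := dual_subl (dual_bounded_integ P) bdg (dual_stablel (dual_bounded_integ P)
      (sG _) (@mG _) (condexp_coordsP X [set j | j != k] idg) bdg).
    exact: dual_integM (dual_bounded_integ P) _ _ BD (Dcoord_mix_integ beta k iZ).
  + by apply: integ_measurable; exact: Dcoord_integ.
- exact: (Dsum_integral_ge0 k h0 h2 (mixZ k)).
- apply: (term_le h1 h12 (Dcoord_mix_integ alpha k iF)); last exact: Dcoord_taylor.
  + have := integB (igD k) (idD k).
    by congr integ; apply/funext => w; rewrite /r; ring.
  + apply: measurable_funB.
      by apply: integ_measurable; apply: Dcoord_integ; exact: square_integrable_integ.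
    apply: measurable_funM; first exact: measurableT_comp mdg mF.
    by apply: integ_measurable; exact: Dcoord_integ.
- exact: (Dsum_integral_ge0 k h1 h12 (mixF k)).
Qed.

End stein_covariance.

(** * Moment bounds for the difference operators *)

Section moment_bounds.
Context d d' (T : measurableType d) (E : measurableType d') (R : realType).
Variables (P : probability T R) (n : nat) (X : 'I_n -> {RV P >-> E}).
Local Notation integ := (integ P).
Local Notation sX := (sigma_coords X).
Implicit Types (U V : T -> R) (k : 'I_n).

Let sG S := sigma_coords_sigma_algebra X S.
Let mG S := @sigma_coords_measurable _ _ _ _ _ _ _ X S.

(** Convexity, then the contraction of moments by each conditional expectation. *)
Lemma Dcoord_mix_moment_le (a : R) k U s : 0 <= a <= 1 -> 1 < s -> integ U ->
  (\int[P]_w (`|Dcoord_mix X a k U w| `^ s)%:E <=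
   \int[P]_w (`|Dcoord X k U w| `^ s)%:E)%E.
Proof.
move=> a01 s1 iU; have iD := Dcoord_integ X k iU; have /andP[a0 a1] := a01.
have a1' : 0 <= 1 - a by rewrite subr_ge0.
have cV S := condexp_coordsP X S iD.
have le S := is_condexp_powR_le (sG S) (@mG S) s1 iD (cV S).
have mV S : measurable_fun setT (condexp P (sX S) (Dcoord X k U)).
  exact: integ_measurable (condexp_coords_integ X S iD).
have mVE S : measurable_fun setT (fun w => (`|condexp P (sX S) (Dcoord X k U) w| `^ s)%:E).
  by apply/measurable_EFinP; exact: measurable_normr_powR.
have p0 S w : (0 <= (`|condexp P (sX S) (Dcoord X k U) w| `^ s)%:E)%E.
  by rewrite lee_fin powR_ge0.
pose I := (\int[P]_w (`|Dcoord X k U w| `^ s)%:E)%E.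
have I0 : (0 <= I)%E by apply: integral_ge0 => w _; rewrite lee_fin powR_ge0.
apply: (@le_trans _ _ (a%:E * I + (1 - a)%:E * I)%E); last first.
  by rewrite -ge0_muleDl ?lee_fin// -EFinD addrC subrK mul1e.
apply: (@le_trans _ _ (\int[P]_w
    (a%:E * (`|condexp P (past X k) (Dcoord X k U) w| `^ s)%:E +
    (1 - a)%:E * (`|condexp P (future X k) (Dcoord X k U) w| `^ s)%:E)%E)%E).
  apply: ge0_le_integral => //.
  - apply/measurable_EFinP; apply: measurable_normr_powR.
    exact: integ_measurable (Dcoord_mix_integ X a k iU).
  - by apply: emeasurable_funD; apply: measurable_funeM; exact: mVE.
  - by move=> w _; rewrite -!EFinM -EFinD lee_fin; exact: powR_convex_comb.
rewrite ge0_integralD//; last 4 first.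
- by move=> w _; apply: mule_ge0; rewrite ?lee_fin// powR_ge0.
- by apply: measurable_funeM; exact: mVE.
- by move=> w _; apply: mule_ge0; rewrite ?lee_fin// powR_ge0.
- by apply: measurable_funeM; exact: mVE.
have Zl (c : R) S (c0 : 0 <= c) := @ge0_integralZl_EFin _ _ _ P setT measurableT _
  (fun w _ => p0 S w) (mVE S) c c0.
have Zle (c : R) S (c0 : 0 <= c) :
    (\int[P]_w (c%:E * (`|condexp P (sX S) (Dcoord X k U) w| `^ s)%:E) <= c%:E * I)%E.
  rewrite [leLHS](Zl c S c0).
  by apply: lee_wpmul2l; rewrite ?lee_fin//; exact: (le S).
exact: (leeD (Zle a _ a0) (Zle (1 - a) _ a1')).
Qed.

Variables (F : T -> R) (F2 : square_integrable P F).
Let D k := Dcoord X k F.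

(** The two summands of [Dsum] have the same bound, since conditioning does not
    increase the moment of order [r]; hence the factor 2. *)
Lemma Dsum_holder (Y : 'I_n -> T -> R) (a r s : R) : 0 <= a -> a <= 2 ->
  (forall k, measurable_fun setT (Y k)) -> 1 < r -> 0 < s -> r^-1 + s^-1 = 1 ->
  (\sum_(k < n) \int[P]_w (Dsum X F a k w * `|Y k w|)%:E <=
   2%:E * ((\sum_(k < n) \int[P]_w (`|D k w| `^ (a * r))%:E) `^ r^-1 *
   (\sum_(k < n) \int[P]_w (`|Y k w| `^ s)%:E) `^ s^-1))%E.
Proof.
move=> a0 a2 mY r1 s0 rs; have r0 : 0 < r by exact: lt_trans r1.
have mnY k : measurable_fun setT (fun w => `|Y k w|) by exact: measurableT_comp.
have iQ k : integ (fun w => `|D k w| `^ a) by exact: integ_powR (Dcoord_sq X k F2) a0 a2.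
pose Ek k := Ecoord X k (fun w => `|D k w| `^ a).
have mEk k : measurable_fun setT (Ek k).
  exact: integ_measurable (condexp_coords_integ X _ (iQ k)).
have mQ k : measurable_fun setT (fun w => `|D k w| `^ a) := integ_measurable (iQ k).
have mnE k : measurable_fun setT (fun w => `|Ek k w|) := measurableT_comp
  (@normr_measurable R setT) (mEk k).
have H1 := @holder_sum _ _ _ P n (fun k w => `|D k w| `^ a) (fun k w => `|Y k w|) r s
  mQ mnY (fun k w => powR_ge0 _ _) (fun k w => normr_ge0 _) r0 s0 rs.
have H2 := @holder_sum _ _ _ P n (fun k w => `|Ek k w|) (fun k w => `|Y k w|) r s
  mnE mnY
  (fun k w => normr_ge0 _) (fun k w => normr_ge0 _) r0 s0 rs.
have pE k w : (`|D k w| `^ a) `^ r = `|D k w| `^ (a * r) by rewrite -powRrM.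
have EA : (\sum_(k < n) \int[P]_w ((`|D k w| `^ a) `^ r)%:E =
  \sum_(k < n) \int[P]_w (`|D k w| `^ (a * r))%:E)%E.
  by apply: eq_bigr => k _; apply: eq_integral => w _; rewrite pE.
have leA : (\sum_(k < n) \int[P]_w (`|Ek k w| `^ r)%:E <=
  \sum_(k < n) \int[P]_w (`|D k w| `^ (a * r))%:E)%E.
  apply: lee_sum => k _.
  have := is_condexp_powR_le (sG _) (@mG _) r1 (iQ k)
    (condexp_coordsP X [set j | j != k] (iQ k)).
  move=> /le_trans; apply; rewrite le_eqVlt; apply/orP; left; apply/eqP.
  by apply: eq_integral => w _; rewrite (ger0_norm (powR_ge0 _ _)) pE.
have split k : (\int[P]_w (Dsum X F a k w * `|Y k w|)%:E =
    \int[P]_w (`|D k w| `^ a * `|Y k w|)%:E + \int[P]_w (`|Ek k w| * `|Y k w|)%:E)%E.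
  have m1 : measurable_fun setT (fun w => (`|D k w| `^ a * `|Y k w|)%:E).
    by apply/measurable_EFinP; exact: measurable_funM (mQ k) (mnY k).
  have m2 : measurable_fun setT (fun w => (`|Ek k w| * `|Y k w|)%:E).
    by apply/measurable_EFinP; exact: measurable_funM (mnE k) (mnY k).
  have m0 : measurable_fun setT (fun w => (Dsum X F a k w * `|Y k w|)%:E).
    apply/measurable_EFinP.
    exact: measurable_funM (measurable_Dsum X F2 k a0 a2) (mnY k).
  have p1 w : setT w -> (0 <= (`|D k w| `^ a * `|Y k w|)%:E)%E.
    by move=> _; rewrite lee_fin mulr_ge0// powR_ge0.
  have p2 w : setT w -> (0 <= (`|Ek k w| * `|Y k w|)%:E)%E.
    by move=> _; rewrite lee_fin mulr_ge0.
  apply: eq_trans (@ge0_integralD _ _ _ P setT measurableT _ _ p1 m1 p2 m2).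
  apply: (ae_eq_integral _ _ measurableT m0 (emeasurable_funD m1 m2)).
  apply: filterS (Ecoord_powR_ge0 X F2 k a0 a2) => w Ew _.
  rewrite -EFinD -mulrDl; congr (_ * _)%:E.
  by rewrite /Dsum (ger0_norm Ew).
rewrite (eq_bigr _ (fun k _ => split k)) big_split/=.
set S1 := (\sum_(k < n) \int[P]_w (`|D k w| `^ a * _)%:E)%E.
set S2 := (\sum_(k < n) \int[P]_w (`|Ek k w| * _)%:E)%E.
have dbl (x : \bar R) : (2%:E * x = x + x)%E by rewrite mule_natl mule2n.
rewrite dbl; apply: leeD; first by rewrite -EA; exact: H1.
apply: (le_trans H2); apply: lee_wpmul2r; first exact: poweR_ge0.
have S0 (f : 'I_n -> T -> R) t : (0 <= \sum_(k < n) \int[P]_w (f k w `^ t)%:E)%E.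
  by apply: sume_ge0 => k _; apply: integral_ge0 => w _; rewrite lee_fin powR_ge0.
apply: gt0_ler_poweR leA; first by rewrite invr_ge0 ltW.
- by rewrite in_itv/= leey andbT S0.
- by rewrite in_itv/= leey andbT S0.
Qed.

End moment_bounds.

(** * Stein's bound on the Wasserstein distance *)

Section lipschitz_test_functions.
Context d dN (T : measurableType d) (TN : measurableType dN) (R : realType).
Variables (P : probability T R) (PN : probability TN R).
Local Notation integ := (integ P).

Lemma measurable_derive (g dg : R -> R) : (forall x : R, is_derive x 1 g (dg x)) ->
  measurable_fun setT g.
Proof. by move=> gd; apply: continuous_measurable_fun => x; exact: is_derive_continuous (gd x). Qed.

(** With [f] the solution of Stein's equation for [h], rescaled to
    [g x = f (x / sigma)], the error [E h(F / sigma) - E h(N)] is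
    [sigma^-1 * (E F^2 * E g'(F) - E (F * g(F)))]; the Hölder constant of [g']
    is [2 / sigma `^ (1 + a)]. *)
Lemma wasserstein_stein_le (N : {RV PN >-> R}) (F : T -> R) (sigma : R) (M : \bar R) :
  (forall A : set R, measurable A -> distribution PN N A = normal_prob 0 1 A) ->
  square_integrable P F -> 0 < sigma -> \int[P]_w (F w ^+ 2) = sigma ^+ 2 ->
  (forall g dg : R -> R, (forall x : R, is_derive x 1 g (dg x)) ->
    measurable_fun setT dg -> (forall x, `|dg x| <= sigma^-1) ->
    (forall x y a, 0 < a -> a <= 1 ->
       `|dg x - dg y| <= 2 / sigma `^ (1 + a) * `|x - y| `^ a) ->
    (`|(\int[P]_w (F w ^+ 2)) * \int[P]_w dg (F w) - \int[P]_w (F w * g (F w))|%:E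
       <= M)%E) ->
  (wasserstein P PN (fun w => F w / sigma)%R N <= (sigma^-1)%:E * M)%E.
Proof.
move=> NN F2 s0 EF2 bound; apply: ge_ereal_sup => _ [h [[hder hcont] hle]] <-.
have iF := square_integrable_integ F2; have mF := integ_measurable iF.
have sn0 : sigma != 0 by rewrite gt_eqF.
have hd (x : R) : is_derive x 1 h (derive1 h x).
  by rewrite derive1E; exact: derivableP.
have h_lip x : `|h x| <= `|h 0| + `|x|.
  have [z _ E0] := mean_value 0 x hd.
  have -> : h x = h 0 + derive1 h z * x by rewrite -[x in _ * x]subr0 -E0; ring.
  by rewrite (le_trans (ler_normD _ _))// lerD2l normrM ler_piMl.
have mh := measurable_derive hd.
have [f [df [fd dfE df1 dfK]]] := stein_smooth hd hle (integrable_lipschitz_gauss mh h_lip).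
have EN := expectation_normal NN mh h_lip.
have [c [{}EN {}dfE]] : exists c : R, ('E_PN[h \o N] = c%:E)%E /\
    forall x, df x = x * f x + (h x - c) by eexists; split; [exact: EN|exact: dfE].
pose g x := f (x * sigma^-1); pose dg x := sigma^-1 * df (x * sigma^-1).
have gd (x : R) : is_derive x 1 g (dg x).
  rewrite /dg mulrC; apply: (@is_derive1_comp _ f (fun y => y * sigma^-1)).
  have := is_derive_mul (is_derive_idfun x) (is_derive_const sigma^-1 x).
  by rewrite mulr0 add0r mulr1.
have mf := measurable_derive fd; have mg := measurable_derive gd.
have mdf : measurable_fun setT df.
  rewrite (_ : df = fun x => x * f x + (h x - c)); last exact/funext.
  apply: measurable_funD; first exact: measurable_funM.
  exact: measurable_funB.
have mdg : measurable_fun setT dg.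
  apply: measurable_funM => //; apply: measurableT_comp mdf _.
  exact: measurable_funM.
have dg1 x : `|dg x| <= sigma^-1.
  by rewrite normrM gtr0_norm ?invr_gt0// ler_piMr// invr_ge0 ltW.
have dgK x y a : 0 < a -> a <= 1 ->
    `|dg x - dg y| <= 2 / sigma `^ (1 + a) * `|x - y| `^ a.
  move=> a0 a1; rewrite /dg -mulrBr normrM gtr0_norm ?invr_gt0//.
  have := dfK (x * sigma^-1) (y * sigma^-1) a a0 a1.
  rewrite -mulrBl normrM (gtr0_norm (x := sigma^-1)) ?invr_gt0//.
  rewrite powRM ?invr_ge0 ?(ltW s0)//.
  rewrite powRD ?sn0 ?implybT// powRr1 ?(ltW s0)//.
  have -> : sigma^-1 `^ a = (sigma `^ a)^-1.
    by rewrite -(powR_inv1 (ltW s0)) -powRrM mulN1r powRN.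
  have sV0 : 0 <= sigma^-1 by rewrite invr_ge0 ltW.
  move=> /(ler_wpM2l sV0) /le_trans; apply; rewrite le_eqVlt; apply/orP; left.
  by apply/eqP; field; rewrite sn0 gt_eqF// powR_gt0.
have g_lip x : `|g x| <= `|g 0| + sigma^-1 * `|x|.
  have [z _ E0] := mean_value 0 x gd.
  have -> : g x = g 0 + dg z * x by rewrite -[x in _ * x]subr0 -E0; ring.
  by rewrite (le_trans (ler_normD _ _))// lerD2l normrM ler_wpM2r.
have gF2 := square_integrable_lipschitz mg g_lip F2.
have iFg := square_integrableM F2 gF2.
have idg : integ (fun w => dg (F w)).
  apply: (integ_le _ (integ_cst P sigma^-1)) => //.
  exact: measurableT_comp mdg mF.
have hE w : h (F w / sigma) = c + (sigma * dg (F w) - sigma^-1 * (F w * g (F w))).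
  by rewrite /g /dg mulrA divff// mul1r dfE; ring.
have i1 := integZ sigma idg; have i2 := integZ sigma^-1 iFg.
have i3 := integB i1 i2; have i0 := integ_cst P c.
have EI : \int[P]_w h (F w / sigma) =
    c + sigma^-1 * ((\int[P]_w (F w ^+ 2)) * \int[P]_w dg (F w)
                    - \int[P]_w (F w * g (F w))).
  rewrite (eq_Rintegral _ (fun w _ => hE w)).
  rewrite (RintegralD measurableT i0 i3) (RintegralB measurableT i1 i2).
  rewrite (RintegralZl sigma measurableT idg) (RintegralZl sigma^-1 measurableT iFg).
  rewrite Rintegral_cst//.
  have -> : fine (P setT) = 1 by rewrite probability_setT.
  rewrite mulr1 EF2.
  by move: (\int[P]_w _) (\int[P]_w _) => u v; field.
have ih : integ (fun w => h (F w / sigma)).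
  by have := integD i0 i3; congr integ; apply/funext => w; rewrite hE.
have -> : ('E_P[h \o (fun w => F w / sigma)%R] = (\int[P]_w h (F w / sigma))%R%:E)%E.
  by rewrite unlock (EFin_Rintegral ih).
rewrite EN -EFinB EI (addrC c) addrK abse_EFin normrM gtr0_norm ?invr_gt0// EFinM.
apply: lee_wpmul2l; first by rewrite lee_fin invr_ge0 ltW.
exact: (bound g dg gd mdg dg1 dgK).
Qed.

End lipschitz_test_functions.

(** * The two bounds *)

Lemma Lfun_square_integrable d (T : measurableType d) (R : realType)
    (P : probability T R) (F : T -> R) (p : R) : 2 <= p -> F \in Lfun P p%:E ->
  F \in Lfun P 2%:E /\ square_integrable P F.
Proof.
move=> p2 Fp; have F2 : F \in Lfun P 2%:E.
  apply: (@Lfun_subset _ _ _ P 2%:E p%:E _ _ _ _ F Fp); rewrite ?lee_fin//.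
  - by rewrite ler1n.
  - by rewrite (le_trans _ p2)// ler1n.
  - exact: fin_num_measure.
split=> //; split; last exact: Lfun2_integrable_sqr.
exact: set_mem (sub_Lfun_mfun Fp).
Qed.

Lemma measurable_wrt_tuple d d' (T : measurableType d) (E : measurableType d')
    (R : realType) (P : probability T R) n (X : 'I_n -> {RV P >-> E})
    (f : n.-tuple E -> R) : measurable_fun setT f ->
  measurable_wrt (sigma_coords X setT) (fun w => f [tuple X i w | i < n]).
Proof.
move=> mf; have sG := sigma_coords_sigma_algebra X setT.
apply/(measurable_wrtP _ sG).
pose Y (w : g_sigma_algebraType (sigma_coords X setT)) := [tuple X i w | i < n].
apply: (measurableT_comp mf (_ : measurable_fun setT Y)).
apply/measurable_fun_tnthP => i _ B mB; rewrite setTI.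
rewrite (_ : _ @^-1` B = X i @^-1` B); last first.
  by apply/funext => w; rewrite /preimage /Y/= tnth_mktuple.
rewrite [measurable]sigma_algebra_id//; exact: sigma_coords_preimage.
Qed.

Theorem theorem2p1 (R : realType)
  (d d' dN : measure_display)
  (T : measurableType d) (E : measurableType d') (TN : measurableType dN)
  (P : probability T R) (PN : probability TN R)
  (N : {RV PN >-> R})
  (N_normal : forall A : set R, measurable A ->
     distribution PN N A = normal_prob 0 1 A)
  (n : nat) (X : 'I_n -> {RV P >-> E})
  (X_indep : mutually_independent X)
  (delta : R) (delta_gt0 : 0 < delta) (delta_le1 : delta <= 1)
  (f : n.-tuple E -> R) (f_meas : measurable_fun setT f)
  (F : T -> R) (F_def : forall w, F w = f [tuple X i w | i < n])
  (F_Lp : F \in Lfun P (2 + delta)%:E)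
  (F_centered : ('E_P[F] = 0)%E)
  (sigma : R) (sigma_gt0 : 0 < sigma)
  (F_var : ('V_P[F] = (sigma ^+ 2)%:E)%E)
  (alpha beta : R)
  (alpha_01 : 0 <= alpha <= 1) (beta_01 : 0 <= beta <= 1) :
  let Z := Zmix X alpha F in
  let D := fun k => Dcoord X k F in
  let bound1 : \bar R :=
    ((2 / sigma `^ (2 + delta))%R%:E *
       (\sum_(k < n)
          'E_P[(fun w => (`|D k w| `^ delta
                          + Ecoord X k (fun w' => `|D k w'| `^ delta) w)
                         * `|Dcoord_mix X beta k Z w|)%R])
     + (2 `^ (1 + delta) / sigma `^ (2 + delta))%R%:E *
       (\sum_(k < n)
          'E_P[(fun w => (`|D k w| `^ (1 + delta)
                          + Ecoord X k (fun w' => `|D k w'| `^ (1 + delta)) w)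
                         * `|Dcoord_mix X alpha k F w|)%R]))%E in
  let bound2 : \bar R :=
    ((4 / sigma `^ (2 + delta))%R%:E
       * (\sum_(k < n) 'E_P[(fun w => `|D k w| `^ (2 + delta))%R])
           `^ (delta / (2 + delta))
       * (\sum_(k < n)
            'E_P[(fun w => `|Dcoord X k Z w| `^ ((2 + delta) / 2))%R])
           `^ (2 / (2 + delta))
     + (2 `^ (2 + delta) / sigma `^ (2 + delta))%R%:E
       * (\sum_(k < n) 'E_P[(fun w => `|D k w| `^ (2 + delta))%R]))%E in
  (wasserstein P PN (fun w => F w / sigma)%R N <= bound1)%E
  /\ (bound1 <= bound2)%E.

Proof.
move=> Z D bound1 bound2.
have p2 : 2 <= 2 + delta by rewrite lerDl ltW.
have [FL2 F2] := Lfun_square_integrable p2 F_Lp.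
have iF := square_integrable_integ F2.
have F0 : \int[P]_w F w = 0.
  apply: EFin_inj; rewrite (EFin_Rintegral iF).
  by move: F_centered; rewrite unlock.
have EF2 : \int[P]_w (F w ^+ 2) = sigma ^+ 2.
  have [_ iF2] := F2; apply: EFin_inj; rewrite (EFin_Rintegral iF2) -F_var.
  by rewrite varianceE// F_centered expe2 mule0 sube0 unlock.
have GF : measurable_wrt (sigma_coords X setT) F.
  rewrite (_ : F = fun w => f [tuple X i w | i < n]); last exact/funext.
  exact: measurable_wrt_tuple.
have EE (Y : T -> R) : ('E_P[Y] = \int[P]_w (Y w)%:E)%E by rewrite unlock.
have delta01 : 0 < delta <= 1 by rewrite delta_gt0.
have d0 := ltW delta_gt0.
have d2 : delta <= 2 by lra.
have e0 : 0 <= 1 + delta by lra.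
have e2 : 1 + delta <= 2 by lra.
have sn0 : sigma != 0 by rewrite gt_eqF.
have s0 := ltW sigma_gt0.
have iZ : integ P Z := Zmix_integ X alpha F2.
pose S1 := (\sum_(k < n)
  \int[P]_w (Dsum X F delta k w * `|Dcoord_mix X beta k Z w|)%:E)%E.
pose S2 := (\sum_(k < n)
  \int[P]_w (Dsum X F (1 + delta) k w * `|Dcoord_mix X alpha k F w|)%:E)%E.
have B1 : bound1 = ((2 / sigma `^ (2 + delta))%:E * S1 +
    (2 `^ (1 + delta) / sigma `^ (2 + delta))%:E * S2)%E.
  by congr (_ * _ + _ * _)%E; apply: eq_bigr => k _; exact: EE.
have mY b k U : integ P U -> measurable_fun setT (Dcoord_mix X b k U).
  by move=> iU; exact: integ_measurable (Dcoord_mix_integ X b k iU).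
split.
- have S10 : (0 <= S1)%E.
    apply: sume_ge0 => k _.
    exact: (Dsum_integral_ge0 X F2 k d0 d2 (mY beta k Z iZ)).
  have S20 : (0 <= S2)%E.
    apply: sume_ge0 => k _.
    exact: (Dsum_integral_ge0 X F2 k e0 e2 (mY alpha k F iF)).
  have pw : sigma^-1 * (2 / sigma `^ (1 + delta)) = 2 / sigma `^ (2 + delta).
    have -> : sigma `^ (2 + delta) = sigma * sigma `^ (1 + delta).
      rewrite -[in RHS](powRr1 s0) -powRrM mul1r.
      rewrite -powRD ?sn0 ?implybT//; congr (_ `^ _); lra.
    by field; rewrite sn0 gt_eqF// powR_gt0.
  have pos : 0 <= 2 / sigma `^ (2 + delta) by rewrite divr_ge0// powR_ge0.
  apply: (@le_trans _ _ ((2 / sigma `^ (2 + delta))%:E * (S1 + S2))%E).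
    rewrite -pw EFinM -muleA.
    apply: (wasserstein_stein_le N_normal F2 sigma_gt0 EF2) => g dg gd mdg dgB dgK.
    apply: (stein_covariance_bound X_indep F2 gd mdg dgB delta01 _ _ _ GF F0).
    by move=> x y; exact: dgK.
  clearbody S1 S2 bound1; rewrite B1 (ge0_muleDr _ S10 S20).
  apply: leeD2l; apply: (lee_wpmul2r S20).
  rewrite lee_fin ler_wpM2r ?invr_ge0 ?powR_ge0//.
  rewrite -[leLHS]powRr1//; apply: ler_powR; first by rewrite ler1n.
  by rewrite lerDl.
- pose M := (\sum_(k < n) \int[P]_w (`|D k w| `^ (2 + delta))%:E)%E.
  pose MZ := (\sum_(k < n) \int[P]_w (`|Dcoord X k Z w| `^ ((2 + delta) / 2))%:E)%E.
  have B2 : bound2 = ((4 / sigma `^ (2 + delta))%:E * M `^ (delta / (2 + delta))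
      * MZ `^ (2 / (2 + delta)) + (2 `^ (2 + delta) / sigma `^ (2 + delta))%:E * M)%E.
    by congr (_ * _ `^ _ * _ `^ _ + _ * _)%E; apply: eq_bigr => k _; exact: EE.
  have pd : 2 + delta != 0 by rewrite gt_eqF//; lra.
  have dn0 : delta != 0 by rewrite gt_eqF.
  have en0 : 1 + delta != 0 by rewrite gt_eqF//; lra.
  have sum0 (V : 'I_n -> T -> R) s : (0 <= \sum_(k < n) \int[P]_w (`|V k w| `^ s)%:E)%E.
    by apply: sume_ge0 => k _; apply: integral_ge0 => w _; rewrite lee_fin powR_ge0.
  have mono (V V' : 'I_n -> T -> R) s : 0 <= s^-1 ->
      (forall k, (\int[P]_w (`|V k w| `^ s)%:E <= \int[P]_w (`|V' k w| `^ s)%:E)%E) ->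
      ((\sum_(k < n) \int[P]_w (`|V k w| `^ s)%:E) `^ s^-1 <=
       (\sum_(k < n) \int[P]_w (`|V' k w| `^ s)%:E) `^ s^-1)%E.
    move=> s1 VV'; apply: (gt0_ler_poweR s1).
    + by rewrite in_itv/= leey andbT sum0.
    + by rewrite in_itv/= leey andbT sum0.
    + by apply: lee_sum => k _; exact: VV'.
  have two0 : (0 <= 2%:E :> \bar R)%E by rewrite lee_fin.
  have L1 : (S1 <= 2%:E * (M `^ (delta / (2 + delta)) * MZ `^ (2 / (2 + delta))))%E.
    have r1 : 1 < (2 + delta) / delta by rewrite ltr_pdivlMr//; lra.
    have s1 : 1 < (2 + delta) / 2 by rewrite ltr_pdivlMr//; lra.
    have rs : ((2 + delta) / delta)^-1 + ((2 + delta) / 2)^-1 = 1.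
      by field; rewrite pd dn0.
    have sV : 0 <= ((2 + delta) / 2)^-1 by rewrite invr_ge0; lra.
    have H := Dsum_holder X F2 d0 d2 (fun k => mY beta k Z iZ) r1 (lt_trans ltr01 s1) rs.
    apply: (le_trans H); rewrite mulrCA divff// mulr1 !invf_div.
    apply: (lee_wpmul2l two0); apply: lee_wpmul2l; first exact: poweR_ge0.
    have := mono _ _ _ sV (fun k => Dcoord_mix_moment_le X k beta_01 s1 iZ).
    by rewrite invf_div.
  have L2 : (S2 <= 2%:E * M)%E.
    have r1 : 1 < (2 + delta) / (1 + delta) by rewrite ltr_pdivlMr; lra.
    have s1 : 1 < 2 + delta by lra.
    have rs : ((2 + delta) / (1 + delta))^-1 + (2 + delta)^-1 = 1.
      by field; rewrite pd en0.
    have sV : 0 <= (2 + delta)^-1 by rewrite invr_ge0; lra.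
    have H := Dsum_holder X F2 e0 e2 (fun k => mY alpha k F iF) r1 (lt_trans ltr01 s1) rs.
    apply: (le_trans H); rewrite mulrCA divff// mulr1.
    apply: (lee_wpmul2l two0).
    have M0 : (0 <= M)%E := sum0 _ _.
    have <- : (M `^ ((2 + delta) / (1 + delta))^-1 * M `^ (2 + delta)^-1 = M)%E.
      by rewrite -poweRD ?rs ?poweRe1// add_neq0_poweRD_def// rs oner_neq0.
    apply: lee_wpmul2l; first exact: poweR_ge0.
    exact: (mono _ _ _ sV (fun k => Dcoord_mix_moment_le X k alpha_01 s1 iF)).
  have pos : 0 <= 2 / sigma `^ (2 + delta) by rewrite divr_ge0// powR_ge0.
  have pos' : 0 <= 2 `^ (1 + delta) / sigma `^ (2 + delta).
    by rewrite divr_ge0// powR_ge0.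
  have c1 : 4 / sigma `^ (2 + delta) = 2 / sigma `^ (2 + delta) * 2.
    by rewrite mulrAC -natrM.
  have c2 : 2 `^ (2 + delta) / sigma `^ (2 + delta) =
      2 `^ (1 + delta) / sigma `^ (2 + delta) * 2.
    rewrite mulrAC; congr (_ / _); rewrite -[X in _ * X]powRr1//.
    by rewrite -powRD ?pnatr_eq0 ?implybT//; congr (_ `^ _); lra.
  clearbody S1 S2 M MZ bound1 bound2.
  rewrite B1 B2 c1 c2 !(EFinM _ 2) -!muleA.
  apply: leeD; apply: lee_wpmul2l => //.
Qed.
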